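(* Let $s\ge0$ and $T>0$. There does not exist any solution $u\in C([-T,T]:H^s(\mathbb R))$ of $$\partial_t u+(1-\partial_x^2)^{-1}(\partial_x u+u\,\partial_x u)=0,\qquad u(x,0)=u_0(x)\in H^s(\mathbb R),$$ for which there exist $t_0\in(-T,T)$ and $a,b\in\mathbb R$ with $a<b$ such that (i) $u(x,t_0)=-1$ for $x\in(a,b)$ (for almost every $x\in(a,b)$ if $s\in[0,1/2]$), and (ii) $\partial_tu(b,t_0)\ge\partial_tu(a,t_0)$.
   Context: $H^s(\mathbb R)=(1-\partial_x^2)^{-s/2}L^2(\mathbb R)$ is the usual $L^2$-based Sobolev space of real-valued functions. The nonlocal term is understood as $(1-\partial_x^2)^{-1}(\partial_xu+u\partial_xu)=\partial_x(1-\partial_x^2)^{-1}\big(u+\tfrac{u^2}{2}\big)$, where $\partial_x(1-\partial_x^2)^{-1}g=K*g$ with $K(x)=-\tfrac12\,\mathrm{sgn}(x)e^{-|x|}$; a solution is a $u\in C([-T,T]:H^s(\mathbb R))$ with $u(t)=u_0-\int_0^t K*\big(u+\tfrac{u^2}{2}\big)(t')\,dt'$. It is known (Bona-Tzvetkov) that for every $s\ge0$, $u_0\in H^s(\mathbb R)$ and $T>0$ such a solution exists and is unique. For such solutions $\partial_tu=-K*(u+\tfrac{u^2}{2})\in C(\mathbb R\times[-T,T])$, so (ii) is meaningful pointwise. *)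

(* Defs.v *)
From HB Require Import structures.
From mathcomp Require Import all_boot all_order all_algebra.
From mathcomp Require Import all_classical all_reals all_analysis.

Set Implicit Arguments.
Unset Strict Implicit.
Unset Printing Implicit Defensive.
Import Order.TTheory GRing.Theory Num.Theory.
Import numFieldNormedType.Exports.
Local Open Scope classical_set_scope.
Local Open Scope ring_scope.

(* Elements of L^2(R) and H^s(R) are represented by functions R -> R, and a
   curve t |-> u(t) in such a space by u : R -> R -> R with time first: u t x.
   Every notion below about elements of L^2 or H^s is invariant under changing
   each u t on a Lebesgue-null set. *)

Definition L2 {R : realType} (f : R -> R) : Prop :=
  f \in Lfun (@lebesgue_measure R) 2%:E.

Definition L2norm {R : realType} (f : R -> R) : \bar R :=
  ('N[@lebesgue_measure R]_2%:E[EFin \o f])%E.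

(* The Fourier-Plancherel transform of f in L^2 is a - i b, with the convention
   \hat f(xi) = \int f(x) e^{-i x xi} dx, the integral being the L^2-limit of
   its truncations to [-n, n]. *)
Definition is_fourier {R : realType} (f a b : R -> R) : Prop :=
  [/\ L2 f, L2 a, L2 b,
    (fun n : nat => L2norm (fun xi =>
      \int[lebesgue_measure]_(x in `[- n%:R, n%:R]) (f x * cos (x * xi))
      - a xi)) @ \oo --> 0%E &
    (fun n : nat => L2norm (fun xi =>
      \int[lebesgue_measure]_(x in `[- n%:R, n%:R]) (f x * sin (x * xi))
      - b xi)) @ \oo --> 0%E].

(* || (1 - d_x^2)^{s/2} f ||_{L^2}
     = ((2 pi)^{-1} \int (1 + xi^2)^s |\hat f(xi)|^2 dxi)^{1/2}.
   The transform is unique up to null sets, so for f in L^2 the infimum ranges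
   over a single value; it is +oo if f is not in L^2. *)
Definition Hs_norm {R : realType} (s : R) (f : R -> R) : \bar R :=
  ereal_inf [set r : \bar R | exists a b, is_fourier f a b /\
    r = (((2 * pi)^-1%:E * \int[lebesgue_measure]_(xi in [set: R])
           ((1 + xi ^+ 2) `^ s * (a xi ^+ 2 + b xi ^+ 2))%:E) `^ 2^-1)%E].

Definition Hs {R : realType} (s : R) (f : R -> R) : Prop :=
  L2 f /\ (Hs_norm s f < +oo)%E.

Definition C_Hs {R : realType} (s T : R) (u : R -> R -> R) : Prop :=
  forall t : R, t \in `[- T, T] -> Hs s (u t) /\
    (fun t' => Hs_norm s (u t' \- u t)) @ within `[- T, T] (nbhs t) --> 0%E.

(* convolution kernel of d_x (1 - d_x^2)^{-1} *)
Definition bbmK {R : realType} (x : R) : R :=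
  - 2^-1 * Num.sg x * expR (- `|x|).

Definition conv {R : realType} (f g : R -> R) (x : R) : R :=
  \int[lebesgue_measure]_(y in [set: R]) (f (x - y) * g y).

Definition bbm_nonlinearity {R : realType} (f : R -> R) : R -> R :=
  conv bbmK (fun y => f y + f y ^+ 2 / 2).

(* \int_0^t g, with the sign convention for t < 0 *)
Definition int0 {R : realType} (g : R -> R) (t : R) : R :=
  if 0 <= t then \int[lebesgue_measure]_(x in `[0, t]) g x
  else - \int[lebesgue_measure]_(x in `[t, 0]) g x.

(* u is a curve of classes, so the Duhamel identity in H^s is an identity for
   almost every x, at each time t; the value at x of the time integral is the
   integral of the values at x. *)
Definition bbm_solution {R : realType} (s T : R) (u0 : R -> R)
    (u : R -> R -> R) : Prop :=
  [/\ Hs s u0, C_Hs s T u & forall t : R, t \in `[- T, T] ->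
    {ae @lebesgue_measure R, forall x : R,
      u t x = u0 x - int0 (fun t' => bbm_nonlinearity (u t') x) t}].

(* v is the pointwise time derivative of the curve of classes u: after choosing
   suitable representatives U t of the classes u t, the derivative exists at
   every point of ]-T, T[ x R, and it is the continuous function v on
   [-T, T] x R.  Continuity makes v unique on [-T, T] x R. *)
Definition is_dt {R : realType} (T : R) (u v : R -> R -> R) : Prop :=
  {within [set p : R * R | p.1 \in `[- T, T]],
    continuous (fun p : R * R => v p.1 p.2)} /\
  exists U : R -> R -> R,
    (forall t : R, t \in `[- T, T] ->
      {ae @lebesgue_measure R, forall x : R, U t x = u t x}) /\
    (forall t x : R, t \in `]- T, T[ -> is_derive t (1 : R) (fun t' => U t' x) (v t x)).

Definition dt {R : realType} (T : R) (u : R -> R -> R) : R -> R -> R :=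
  xget (fun _ _ => 0) [set v | is_dt T u v].

(* f = c on (a, b), read almost everywhere when s <= 1/2, and otherwise
   everywhere for the continuous representative of f in H^s. *)
Definition eq_cst_on {R : realType} (s : R) (f : R -> R) (c a b : R) : Prop :=
  if s <= 2^-1 then
    {ae @lebesgue_measure R, forall x : R, x \in `]a, b[ -> f x = c}
  else exists g : R -> R,
    [/\ continuous g, {ae @lebesgue_measure R, forall x : R, g x = f x} &
        forall x, x \in `]a, b[ -> g x = c].

(* Main.v *)
Require Import Defs.
From mathcomp Require Import all_boot all_order all_algebra.
From mathcomp Require Import all_classical all_reals all_analysis.
From mathcomp Require Import measurable_realfun ring lra.
Set Implicit Arguments.
Unset Strict Implicit.
Unset Printing Implicit Defensive.
Import Order.TTheory GRing.Theory Num.Theory.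
Import numFieldNormedType.Exports.
Local Open Scope classical_set_scope.
Local Open Scope ring_scope.

(* On the interval where u = -1 the nonlinearity u + u^2/2 = ((u + 1)^2 - 1)/2 is
   minimal.  As K has zero mean, d_t u = - K * h with h = (u + 1)^2/2 >= 0, and
   d_t u(b) - d_t u(a) is minus the integral of (K(b - y) - K(a - y)) h(y); the
   kernel difference is positive off [a, b] and h vanishes on (a, b).  So (ii)
   forces h = 0, i.e. u = -1 almost everywhere, and u is not in L^2.

   That d_t u is the continuous function - K * (u + u^2/2) needs the L^2
   continuity of t |-> u(t), hence a lower Plancherel bound for the transform.
   It comes by duality: for integrable f and bounded continuous k, the integral
   of e^{-e xi} Re(\hat f conj(\hat k)) over xi >= 0 is the pairing of f with the
   Poisson mean of k, which tends to pi <f, k> as e -> 0.  Cauchy-Schwarz gives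
   pi <f, k> <= (||\hat f||^2 + pi ||k||^2)/2, and k is taken to be box averages of a
   truncation of f. *)

(** * Integrals of real functions *)

(** The obstacle is that (ii) concerns point values of a derivative selected by [xget], while each
    u(t) is a class with its own null set. Two admissible derivatives are therefore compared along
    one sequence of times, where only countably many null sets occur; continuity in x then gives
    every point.

    L^2 continuity matters because the flux is quadratic: the change of K * (u + u^2/2) between two
    times is bounded, uniformly in x, by a small multiple of a constant plus ||u||^2, and a large
    multiple of ||u(t') - u(t)||^2. The H^s norm is defined on the frequency side, so its smallness
    has to be carried back to the function.

    The choice of k closes the duality: for a truncation of f one has f k = k^2, so half of pi
    ||k||^2 is absorbed and the bound no longer depends on the truncation. The Abel weight makes the
    frequency integrals converge before any decay of the transforms is known. Constants are lost
    freely, since the bound only serves to show that something tends to 0. *)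

Section real_integral.
Context {R : realType}.
Local Notation mu := (@lebesgue_measure R).
Local Notation integ f := (mu.-integrable [set: R] (EFin \o f)).
Implicit Types f g h : R -> R.

Lemma ae_imp (P Q : R -> Prop) : (forall x, P x -> Q x) ->
  {ae mu, forall x, P x} -> {ae mu, forall x, Q x}.
Proof. by move=> PQ; apply: filterS; first exact: (ae_filter_ringOfSetsType mu). Qed.

Lemma ae_imp2 (P Q S : R -> Prop) : (forall x, P x -> Q x -> S x) ->
  {ae mu, forall x, P x} -> {ae mu, forall x, Q x} -> {ae mu, forall x, S x}.
Proof. by move=> PQ; apply: filterS2; first exact: (ae_filter_ringOfSetsType mu). Qed.

Lemma integ_measurable f : integ f -> measurable_fun [set: R] f.
Proof. by move=> /measurable_int /measurable_EFinP. Qed.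

Lemma integ_le f g : measurable_fun [set: R] f ->
  (forall x, `|f x| <= g x) -> integ g -> integ f.
Proof.
move=> mf fg; apply: le_integrable => //; first exact/measurable_EFinP.
by move=> x _ /=; rewrite lee_fin (le_trans (fg x))// ler_norm.
Qed.

Lemma integD f g : integ f -> integ g -> integ (fun x => f x + g x).
Proof. by move=> intf intg; exact: integrableD measurableT _ _ intf intg. Qed.

Lemma integZ (c : R) f : integ f -> integ (fun x => c * f x).
Proof. by move=> intf; exact: integrableZl measurableT c _ intf. Qed.

Lemma integB f g : integ f -> integ g -> integ (fun x => f x - g x).
Proof.
move=> intf /(integZ (-1)) intg.
by under [in X in _.-integrable _ X]eq_fun do rewrite -mulN1r; exact: integD.
Qed.

Lemma integM_bounded f h (M : R) : integ f -> measurable_fun [set: R] h ->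
  (forall x, `|h x| <= M) -> integ (fun x => f x * h x).
Proof.
move=> intf mh hM; apply: (@integ_le _ (fun x => M * `|f x|)).
- by apply: measurable_funM => //; exact: integ_measurable.
- by move=> x; rewrite normrM mulrC ler_wpM2r.
- by apply: integZ; exact: integrable_norm intf.
Qed.

Lemma integ_ge0_fin f : measurable_fun [set: R] f -> (forall x, 0 <= f x) ->
  (\int[mu]_x (f x)%:E < +oo)%E -> integ f.
Proof.
move=> mf f0 foo; apply/integrableP; split; first exact/measurable_EFinP.
by under eq_integral do rewrite gee0_abs ?lee_fin//.
Qed.

Lemma Rintegral_dct (f_ : nat -> R -> R) f g :
  (forall n, measurable_fun [set: R] (f_ n)) -> measurable_fun [set: R] f ->
  {ae mu, forall x, (f_ ^~ x) n @[n --> \oo] --> f x} ->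
  integ g -> (forall n x, `|f_ n x| <= g x) ->
  \int[mu]_(x in [set: R]) f_ n x @[n --> \oo] --> \int[mu]_(x in [set: R]) f x.
Proof.
move=> mf_ mf cf intg fg.
have cf' : {ae mu, forall x, [set: R] x -> (EFin \o f_ n) x @[n --> \oo] --> (EFin \o f) x}.
  by apply: ae_imp cf => x cfx _; apply: cvg_EFin => //; exact: nearW.
have fg' : {ae mu, forall x n, [set: R] x -> (`|(EFin \o f_ n) x| <= (EFin \o g) x)%E}.
  by apply: aeW => x n _; rewrite /= lee_fin.
have [intf _ cvf] := @dominated_convergence _ _ _ mu _ measurableT _ _ _
  (fun n => (measurable_EFinP _ _).2 (mf_ n)) ((measurable_EFinP _ _).2 mf)
  cf' intg fg'.
by apply: fine_cvg; rewrite fineK//; exact: integrable_fin_num.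
Qed.

(** The product M |f(x)| |g(y)| dominates the integrand. In this shape the exchange applies both to
    the Abel weight against f and to the Abel weight against k. *)
Lemma Rintegral_Fubini f g (phi : R -> R -> R) (M : R) : integ f -> integ g ->
  measurable_fun [set: R * R] (fun p : R * R => phi p.1 p.2) ->
  (forall x y, `|phi x y| <= M) ->
  \int[mu]_(x in [set: R]) (f x * \int[mu]_(y in [set: R]) (g y * phi x y)) =
  \int[mu]_(y in [set: R]) (g y * \int[mu]_(x in [set: R]) (f x * phi x y)).
Proof.
move=> intf intg mphi phiM.
have mf := integ_measurable intf; have mg := integ_measurable intg.
have mphi1 y : measurable_fun [set: R] (phi ^~ y).
  exact: (measurableT_comp mphi (pair2_measurable y)).
have mphi2 x : measurable_fun [set: R] (phi x).
  exact: (measurableT_comp mphi (pair1_measurable x)).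
pose F (p : R * R) := f p.1 * (g p.2 * phi p.1 p.2).
have mF : measurable_fun [set: R * R] (EFin \o F).
  apply/measurable_EFinP; apply: measurable_funM.
    exact: measurableT_comp.
  by apply: measurable_funM => //; exact: measurableT_comp.
have intF : (mu \x mu)%E.-integrable setT (EFin \o F).
  apply/integrable12ltyP => //=.
  apply: (@le_lt_trans _ _
    (\int[mu]_x (`|f x| * (M * \int[mu]_(y in [set: R]) `|g y|))%:E)%E).
    apply: ge0_le_integral => //.
    - by move=> x _; apply: integral_ge0.
    - apply: (@measurable_fun_fubini_tonelli_F _ _ _ _ _ mu (abse \o (EFin \o F))).
        exact: measurableT_comp.
      by move=> p; exact: abse_ge0.
    - apply/measurable_EFinP; apply: measurable_funM => //.
      exact: measurableT_comp.
    - move=> x _.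
      have intgM : integ (fun y => `|f x| * (M * `|g y|)).
        by do 2 apply: integZ; exact: integrable_norm intg.
      rewrite -RintegralZl//; last exact: integrable_norm intg.
      rewrite -RintegralZl//; last by apply: integZ; exact: integrable_norm intg.
      rewrite /Rintegral fineK; last exact: integrable_fin_num intgM.
      apply: ge0_le_integral => //.
      + apply/measurable_EFinP; apply: measurableT_comp => //.
        rewrite /F/=; apply: (measurable_funM (measurable_cst _)).
        exact: (measurable_funM mg (mphi2 x)).
      + exact: (measurable_int mu).
      + move=> y _; rewrite lee_fin /F/= !normrM ler_wpM2l// mulrC ler_wpM2r//.
  have /integrable_fin_num : integ (fun x => (M * \int[mu]_(y in [set: R]) `|g y|) * `|f x|).
    by apply: integZ; exact: integrable_norm intf.
  move=> /(_ measurableT).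
  under [in X in X -> _]eq_integral do rewrite /= mulrC.
  by rewrite ge0_fin_numE; [|apply: integral_ge0 => x _; rewrite lee_fin mulr_ge0// mulr_ge0//;
    [exact: le_trans (normr_ge0 _) (phiM 0 0)|exact: Rintegral_ge0]].
have eL x : ((f x * \int[mu]_(y in [set: R]) (g y * phi x y))%:E =
    \int[mu]_y (F (x, y))%:E)%E.
  have intp : integ (fun y => g y * phi x y).
    exact: integM_bounded intg (mphi2 x) (phiM x).
  rewrite -RintegralZl// /Rintegral fineK//.
  by apply: (integrable_fin_num measurableT); exact: (integZ (f x) intp).
have eR y : ((g y * \int[mu]_(x in [set: R]) (f x * phi x y))%:E =
    \int[mu]_x (F (x, y))%:E)%E.
  have intp : integ (fun x => f x * phi x y).
    exact: integM_bounded intf (mphi1 y) (phiM^~ y).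
  rewrite -RintegralZl// /Rintegral fineK//.
    by apply: eq_integral => x _; congr EFin; rewrite /F /=; ring.
  by apply: (integrable_fin_num measurableT); exact: (integZ (g y) intp).
transitivity (fine (\int[mu]_x \int[mu]_y (F (x, y))%:E)%E).
  by congr (fine _); apply: eq_integral => x _; exact: eL.
rewrite (Fubini intF).
by congr (fine _); apply: eq_integral => y _; rewrite eR.
Qed.

End real_integral.

(** * The Poisson kernel as an Abel mean *)

Section poisson_kernel.
Context {R : realType}.
Local Notation mu := (@lebesgue_measure R).
Local Notation integ f := (mu.-integrable [set: R] (EFin \o f)).

(** The Abel weight, cut to a half-line so that its cosine transform is one improper integral with
    an explicit antiderivative. *)
Definition half_expR (e xi : R) : R := if 0 <= xi then expR (- (e * xi)) else 0.

Lemma half_expR_ge0 e xi : 0 <= half_expR e xi.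
Proof. by rewrite /half_expR; case: ifP => // _; exact: expR_ge0. Qed.

Lemma half_expR_le1 e xi : 0 <= e -> half_expR e xi <= 1.
Proof.
move=> e0; rewrite /half_expR; case: ifP => // xi0.
by rewrite -expR0 ler_expR oppr_le0 mulr_ge0.
Qed.

Lemma cvg_expRN_scale (e : R) : 0 < e -> expR (- (e * x)) @[x --> +oo] --> (0:R).
Proof.
move=> e0.
apply: (cvg_comp (fun x => e * x) (fun x => expR (- x))); last exact: cvgr_expR.
by apply: gt0_cvgMry => //; exact: cvg_id.
Qed.

(** Adding 1 to the cosine makes the integrand nonnegative, so the fundamental theorem of calculus
    on a half-line applies before integrability is known. The extra term is subtracted later. *)
Lemma integral_expR_cos1 (e z : R) : 0 < e ->
  (\int[mu]_(xi in `[0%R, +oo[) (expR (- (e * xi)) * (1 + cos (z * xi)))%:E =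
   (e^-1 + e / (e ^+ 2 + z ^+ 2))%:E)%E.
Proof.
move=> e0.
have D0 : e ^+ 2 + z ^+ 2 != 0 by rewrite gt_eqF// ltr_wpDr ?sqr_ge0// exprn_gt0.
have en0 : e != 0 by rewrite gt_eqF.
pose F (x : R) := expR (- (e * x)) *
  (- e^-1 + (z * sin (z * x) - e * cos (z * x)) / (e ^+ 2 + z ^+ 2)).
have dF x : is_derive x (1:R) F (expR (- (e * x)) * (1 + cos (z * x))).
  rewrite /F; apply: is_derive_eq.
  rewrite /= /GRing.scale/=.
  field.
  by rewrite D0 en0.
rewrite (@ge0_continuous_FTC2y _ _ F 0 0).
- rewrite /F !mulr0 oppr0 expR0 sin0 cos0 mulr0 mulr1 mul1r -EFinB; congr EFin.
  by field; rewrite D0 en0.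
- move=> x _; apply: mulr_ge0; first exact: expR_ge0.
  by rewrite addrC -lerBlDr sub0r cos_geN1.
- apply: continuous_subspaceT => x.
  apply: cvgM.
    apply: continuous_comp; last exact: continuous_expR.
    by apply: cvgN; apply: cvgM => //; exact: cvg_cst.
  apply: cvgD; first exact: cvg_cst.
  apply: continuous_comp; last exact: continuous_cos.
  by apply: cvgM => //; exact: cvg_cst.
(* [M] bounds the trigonometric factor of [F] uniformly in x, so the exponential factor sends [F] to
   0. *)
- pose M := e^-1 + (`|z| + e) / (e ^+ 2 + z ^+ 2).
  apply/cvgr0Pnorm_le => d d0.
  have M0 : 0 < M.
    rewrite ltr_pwDl ?invr_gt0// divr_ge0 ?addr_ge0 ?sqr_ge0//.
    exact: ltW.
  have /cvgr0Pnorm_lt /(_ (d / M) ltac:(by rewrite divr_gt0)) := cvg_expRN_scale e0.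
  apply: filterS => x; rewrite /F => hx; rewrite normrM.
  have Hx : `|- e^-1 + (z * sin (z * x) - e * cos (z * x)) / (e ^+ 2 + z ^+ 2)| <= M.
    rewrite /M; apply: (le_trans (ler_normD _ _)); apply: lerD.
      by rewrite normrN ger0_norm// invr_ge0 ltW.
    rewrite normrM normfV (@ger0_norm _ (e ^+ 2 + z ^+ 2)) ?addr_ge0 ?sqr_ge0//.
    rewrite ler_wpM2r ?invr_ge0 ?addr_ge0 ?sqr_ge0//.
    apply: (le_trans (ler_normB _ _)); rewrite !normrM (@ger0_norm _ e) ?(ltW e0)//.
    apply: lerD.
      by rewrite ler_piMr// ler_norml sin_geN1 sin_le1.
    by rewrite ler_piMr ?(ltW e0)// ler_norml cos_geN1 cos_le1.
  apply: (le_trans (ler_pM _ _ (ltW hx) Hx)) => //.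
  by rewrite divfK// gt_eqF.
- by move=> x _; exact: ex_derive.
- apply: cvg_at_right_filter; apply: differentiable_continuous.
  by apply/derivable1_diffP; exact: ex_derive.
- by move=> x _; rewrite derive1E derive_val.
Qed.

Lemma measurable_half_expR e : measurable_fun [set: R] (half_expR e).
Proof.
have -> : half_expR e = (fun x => expR (- (e * x))) \_ `[0, +oo[.
  by apply/funext => x; rewrite patchE /half_expR mem_setE in_itv/= andbT.
apply/(measurable_restrictT _ _).1 => //.
apply: measurable_funTS; apply: continuous_measurable_fun => x.
apply: continuous_comp; last exact: continuous_expR.
by apply: cvgN; apply: cvgM => //; exact: cvg_cst.
Qed.

Lemma continuous_cosM z : continuous (fun xi : R => cos (z * xi)).
Proof.
move=> x; apply: continuous_comp; last exact: continuous_cos.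
by apply: cvgM => //; exact: cvg_cst.
Qed.

Lemma cos_norm_le1 (x : R) : `|cos x| <= 1.
Proof. by rewrite ler_norml cos_geN1 cos_le1. Qed.

Lemma sin_norm_le1 (x : R) : `|sin x| <= 1.
Proof. by rewrite ler_norml sin_geN1 sin_le1. Qed.

Lemma integral_half_expR_cos1 (e z : R) : 0 < e ->
  (\int[mu]_xi (half_expR e xi * (1 + cos (z * xi)))%:E =
   (e^-1 + e / (e ^+ 2 + z ^+ 2))%:E)%E.
Proof.
move=> e0; rewrite -integral_expR_cos1// [RHS]integral_mkcond.
apply: eq_integral => xi _; rewrite patchE /half_expR mem_setE in_itv/= andbT.
by case: ifP; rewrite ?mul0r.
Qed.

Lemma integ_half_expR (e : R) : 0 < e -> integ (half_expR e).
Proof.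
move=> e0.
have -> : half_expR e = (fun x => 2^-1 * (half_expR e x * (1 + cos (0 * x)))).
  by apply/funext => x; rewrite mul0r cos0; field.
apply: integZ; apply: integ_ge0_fin.
- apply: measurable_funM; first exact: measurable_half_expR.
  apply: measurable_funD => //; apply: continuous_measurable_fun.
  exact: continuous_cosM.
- by move=> x; rewrite mul0r cos0 mulr_ge0// half_expR_ge0.
- by rewrite integral_half_expR_cos1// ltry.
Qed.

Lemma Rintegral_half_expR_cos (e z : R) : 0 < e ->
  \int[mu]_(xi in [set: R]) (half_expR e xi * cos (z * xi)) =
  e / (e ^+ 2 + z ^+ 2).
Proof.
move=> e0.
have integc z' : integ (fun xi => half_expR e xi * cos (z' * xi)).
  apply: (integM_bounded (integ_half_expR e0) _ (fun x => cos_norm_le1 (z' * x))).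
  by apply: continuous_measurable_fun; exact: continuous_cosM.
have H z' : e^-1 + e / (e ^+ 2 + z' ^+ 2) =
    \int[mu]_(xi in [set: R]) half_expR e xi +
    \int[mu]_(xi in [set: R]) (half_expR e xi * cos (z' * xi)).
  rewrite -RintegralD//; last exact: integ_half_expR.
  under eq_Rintegral do rewrite -[X in X + _]mulr1 -mulrDr.
  by rewrite /Rintegral integral_half_expR_cos1.
(* At z = 0 the cosine is 1, so the identity reads 2/e on the left and twice the mass of the weight
   on the right. This gives the mass to be subtracted. *)
have := H 0; under [in X in _ = _ + X]eq_Rintegral do rewrite mul0r cos0 mulr1.
move=> H0.
have -> : \int[mu]_(xi in [set: R]) (half_expR e xi * cos (z * xi)) =
  e^-1 + e / (e ^+ 2 + z ^+ 2) - \int[mu]_(xi in [set: R]) half_expR e xi.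
  by rewrite H addrAC subrr add0r.
have -> : \int[mu]_(xi in [set: R]) half_expR e xi = e^-1.
  apply: (@mulfI _ 2) => //; rewrite mulr_natl mulr2n -H0 expr0n/= addr0.
  by field; rewrite gt_eqF.
by rewrite addrAC subrr add0r.
Qed.

Lemma integral_oneDsqrV : (\int[mu]_x (oneDsqr x)^-1%:E = pi%:E :> \bar R)%E.
Proof.
rewrite (@ge0_symfun_integralT _ (fun x => (oneDsqr x)^-1)).
- have -> : [set x : R | 0 <= x] = [set` `[0, +oo[].
    by apply/seteqP; split => x /=; rewrite in_itv/= andbT.
  by rewrite integral0y_oneDsqr -EFinM; congr EFin; field.
- by move=> x; rewrite invr_ge0.
- exact: continuous_oneDsqrV.
- by move=> x; rewrite /= /oneDsqr sqrrN.
Qed.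

Lemma integ_oneDsqrV : integ (fun x : R => (oneDsqr x)^-1).
Proof.
apply: integ_ge0_fin; [|by move=> x; rewrite invr_ge0|].
  by apply: continuous_measurable_fun; exact: continuous_oneDsqrV.
by rewrite integral_oneDsqrV ltry.
Qed.

Lemma integral_ge0_affine (G : R -> R) (x e : R) : 0 < e -> continuous G ->
  (forall y, 0 <= G y) ->
  (\int[mu]_y (G y)%:E = \int[mu]_z (G (x + e * z) * e)%:E)%E.
Proof.
move=> e0 cG G0; pose F z := x + e * z.
have dF z : is_derive z (1:R) F e.
  by rewrite /F; apply: is_derive_eq; rewrite /GRing.scale/=; ring.
have F'E : F^`()%classic = cst e.
  by apply/funext => z; rewrite derive1E derive_val.
have Fhomo : {homo F : a b / a < b} by move=> a b ab; rewrite /F ltrD2l ltr_pM2l.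
have cF' : continuous F^`()%classic by rewrite F'E; move=> ?; exact: cvg_cst.
have cvF'Ny : cvg (F^`()%classic z @[z --> -oo]) by rewrite F'E; exact: is_cvg_cst.
have cvF'y : cvg (F^`()%classic z @[z --> +oo]) by rewrite F'E; exact: is_cvg_cst.
have dF1 z : derivable F z 1 by have [] := dF z.
have cvFNy : F z @[z --> -oo] --> -oo.
  apply: (cvg_comp (fun z => e * z) (fun r => x + r)); last exact: cvg_addrl_Ny.
  exact: gt0_cvgMrNy cvg_id.
have cvFy : F z @[z --> +oo] --> +oo.
  apply: (cvg_comp (fun z => e * z) (fun r => x + r)); last exact: cvg_addrl.
  exact: gt0_cvgMry cvg_id.
rewrite (increasing_ge0_integration_by_substitutionT Fhomo cF' cvF'Ny cvF'y dF1
  cvFNy cvFy cG G0).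
by apply: eq_integral => z _; rewrite F'E.
Qed.
(** This is pi times the Poisson kernel of the half-plane at height e; its total mass is pi. *)
Definition poisson (e z : R) : R := e / (e ^+ 2 + z ^+ 2).

Lemma poisson_den_gt0 (e z : R) : 0 < e -> 0 < e ^+ 2 + z ^+ 2.
Proof. by move=> e0; rewrite ltr_wpDr ?sqr_ge0// exprn_gt0. Qed.

Lemma poisson_ge0 e z : 0 < e -> 0 <= poisson e z.
Proof. by move=> e0; rewrite divr_ge0 ?ltW// poisson_den_gt0. Qed.

Lemma poisson_le e z : 0 < e -> poisson e z <= e^-1.
Proof.
move=> e0; rewrite /poisson ler_pdivrMr ?poisson_den_gt0//.
by rewrite mulrDr expr2 mulKf ?gt_eqF// lerDl mulr_ge0 ?sqr_ge0// invr_ge0 ltW.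
Qed.

Lemma continuous_poisson e : 0 < e -> continuous (poisson e).
Proof.
move=> e0 z; apply: cvgM; first exact: cvg_cst.
apply: cvgV; first by rewrite gt_eqF// poisson_den_gt0.
by apply: cvgD; [exact: cvg_cst|exact: exprn_continuous].
Qed.

Lemma continuous_poissonB e x : 0 < e -> continuous (fun y => poisson e (x - y)).
Proof.
move=> e0 y; apply: (@continuous_comp _ _ _ (fun y => x - y) (poisson e)).
  by apply: cvgB; [exact: cvg_cst|exact: cvg_id].
exact: continuous_poisson.
Qed.

Lemma poisson_affine e x z : 0 < e ->
  poisson e (x - (x + e * z)) * e = (oneDsqr z)^-1.
Proof.
move=> e0; rewrite /poisson opprD addNKr sqrrN exprMn.
have -> : e ^+ 2 + e ^+ 2 * z ^+ 2 = e * (e * oneDsqr z) by rewrite /oneDsqr; ring.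
rewrite invfM mulrA divff ?gt_eqF// mul1r invfM mulrAC mulVf ?gt_eqF//.
by rewrite mul1r.
Qed.

Lemma continuous_comp_affine (k : R -> R) (x e : R) :
  continuous k -> continuous (fun z => k (x + e * z)).
Proof.
move=> ck z; apply: (@continuous_comp _ _ _ (fun z => x + e * z) k); last exact: ck.
by apply: cvgD; [exact: cvg_cst|apply: cvgM; [exact: cvg_cst|exact: cvg_id]].
Qed.

Lemma Rintegral_ge0_poisson e (k : R -> R) M x : 0 < e -> continuous k ->
  (forall y, 0 <= k y <= M) ->
  integ (fun y => k y * poisson e (x - y)) /\
  \int[mu]_(y in [set: R]) (k y * poisson e (x - y)) =
  \int[mu]_(z in [set: R]) (k (x + e * z) * (oneDsqr z)^-1).
Proof.
move=> e0 ck kM.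
have ckp : continuous (fun y => k y * poisson e (x - y)).
  by move=> y; apply: cvgM; [exact: ck|exact: continuous_poissonB].
have kp0 y : 0 <= k y * poisson e (x - y).
  by rewrite mulr_ge0 ?poisson_ge0//; have /andP[] := kM y.
have cka := @continuous_comp_affine k x e ck.
have H := integral_ge0_affine x e0 ckp kp0.
have {}H : (\int[mu]_y (k y * poisson e (x - y))%:E =
    \int[mu]_z (k (x + e * z) * (oneDsqr z)^-1)%:E)%E.
  by rewrite H; apply: eq_integral => z _; rewrite -mulrA poisson_affine.
have intka : integ (fun z => (oneDsqr z)^-1 * k (x + e * z)).
  apply: (@integM_bounded _ _ _ M integ_oneDsqrV).
    exact: continuous_measurable_fun.
  by move=> z; have /andP[? ?] := kM (x + e * z); rewrite ger0_norm.
split; last by rewrite /Rintegral H.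
apply: integ_ge0_fin => //; first exact: continuous_measurable_fun.
rewrite H -ge0_fin_numE; last first.
  by apply: integral_ge0 => z _; rewrite lee_fin mulr_ge0 ?invr_ge0//;
     have /andP[] := kM (x + e * z).
under eq_integral do rewrite mulrC.
exact: (integrable_fin_num measurableT intka).
Qed.

Lemma integ_poisson e x : 0 < e -> integ (fun y => poisson e (x - y)).
Proof.
move=> e0; have [] := @Rintegral_ge0_poisson e (cst 1) 1 x e0.
- by move=> ?; exact: cvg_cst.
- by move=> y; rewrite /= ler01 lexx.
by under [in X in X -> _]eq_fun do rewrite mul1r.
Qed.

(** The substitution is available for nonnegative functions, so it is applied to k + M, with values
    in [0, 2M], and to the constant M; the difference gives the signed case. *)
Lemma Rintegral_poisson e (k : R -> R) M x : 0 < e -> continuous k ->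
  (forall y, `|k y| <= M) ->
  \int[mu]_(y in [set: R]) (k y * poisson e (x - y)) =
  \int[mu]_(z in [set: R]) (k (x + e * z) * (oneDsqr z)^-1).
Proof.
move=> e0 ck kM.
have M0 : 0 <= M := le_trans (normr_ge0 _) (kM 0).
have mp : measurable_fun [set: R] (fun y => poisson e (x - y)).
  by apply: continuous_measurable_fun; exact: continuous_poissonB.
have mk : measurable_fun [set: R] k by exact: continuous_measurable_fun.
have mka : measurable_fun [set: R] (fun z => k (x + e * z)).
  by apply: continuous_measurable_fun; exact: continuous_comp_affine.
have [intM eM] := @Rintegral_ge0_poisson e (cst M) M x e0
  (fun=> cvg_cst _) (fun=> introT andP (conj M0 (lexx M))).
have ckM : continuous (fun y => k y + M).
  by move=> y; apply: cvgD; [exact: ck|exact: cvg_cst].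
have kMM y : 0 <= k y + M <= M + M.
  by have := kM y; rewrite ler_norml => /andP[? ?]; rewrite lerD2r -lerBlDr sub0r; apply/andP.
have [intkM ekM] := @Rintegral_ge0_poisson e _ (M + M) x e0 ckM kMM.
have intk : integ (fun y => k y * poisson e (x - y)).
  under [in X in _.-integrable _ X]eq_fun do rewrite mulrC.
  exact: integM_bounded (integ_poisson x e0) mk kM.
have intka : integ (fun z => k (x + e * z) * (oneDsqr z)^-1).
  under [in X in _.-integrable _ X]eq_fun do rewrite mulrC.
  exact: (integM_bounded integ_oneDsqrV mka).
apply: (@addIr _ (\int[mu]_(y in [set: R]) (M * poisson e (x - y)))).
rewrite [in RHS]eM -!RintegralD//; last by apply: integZ; exact: integ_oneDsqrV.
under [in RHS]eq_Rintegral do rewrite -mulrDl.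
by under eq_Rintegral do rewrite -mulrDl.
Qed.

(** After y = x + e z the kernel is fixed and e appears only inside k, so dominated convergence with
    majorant M / (1 + z^2) applies. *)
Lemma cvg_poisson (k : R -> R) M x : continuous k -> (forall y, `|k y| <= M) ->
  \int[mu]_(y in [set: R]) (k y * poisson n.+1%:R^-1 (x - y)) @[n --> \oo]
  --> pi * k x.
Proof.
move=> ck kM.
have -> : pi * k x = \int[mu]_(z in [set: R]) (k x * (oneDsqr z)^-1).
  rewrite RintegralZl//; last exact: integ_oneDsqrV.
  by rewrite /Rintegral integral_oneDsqrV mulrC.
under eq_fun do rewrite (Rintegral_poisson _ _ ck kM) ?invr_gt0//.
apply: (@Rintegral_dct _ _ _ (fun z => M * (oneDsqr z)^-1)).
- move=> n; apply: measurable_funM.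
    by apply: continuous_measurable_fun; exact: continuous_comp_affine.
  by apply: continuous_measurable_fun; exact: continuous_oneDsqrV.
- apply: measurable_funM => //.
  by apply: continuous_measurable_fun; exact: continuous_oneDsqrV.
- apply: aeW => z; apply: cvgM; last exact: cvg_cst.
  have H : (x + n.+1%:R^-1 * z) @[n --> \oo] --> x.
    rewrite -[X in _ --> X]addr0; apply: cvgD; first exact: cvg_cst.
    rewrite -(mul0r z); apply: cvgM; last exact: cvg_cst.
    exact: cvg_harmonic.
  exact: cvg_comp H (ck x).
- by apply: integZ; exact: integ_oneDsqrV.
- move=> n z; rewrite normrM (@ger0_norm _ (oneDsqr z)^-1) ?invr_ge0//.
  by rewrite ler_wpM2r// invr_ge0.
Qed.

End poisson_kernel.

(** * A lower Plancherel bound *)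

Section fourier_pairing.
Context {R : realType}.
Local Notation mu := (@lebesgue_measure R).
Local Notation integ f := (mu.-integrable [set: R] (EFin \o f)).

Implicit Types (f k : R -> R) (e M x z xi : R).

Lemma continuous_Rintegral_bounded (g : R -> R) (phi : R -> R -> R) (M : R) :
  integ g -> (forall x, measurable_fun [set: R] (phi x)) ->
  (forall y, continuous (phi ^~ y)) -> (forall x y, `|phi x y| <= M) ->
  continuous (fun x => \int[mu]_(y in [set: R]) (g y * phi x y)).
Proof.
move=> intg mphi cphi phiM x.
apply: (@continuity_under_integral _ _ _ mu (fun x y => g y * phi x y) setT
  measurableT (x - 1) (x + 1) _ _ (fun y => M * `|g y|)).
- by move=> z _; exact: integM_bounded.
- apply: aeW => y _ z _; apply: cvgM; first exact: cvg_cst.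
  exact: cphi.
- by apply: integZ; exact: integrable_norm intg.
- by move=> z _; apply: aeW => y _; rewrite normrM mulrC ler_wpM2r.
- by rewrite inE/= in_itv/= ltrDl ltrBlDr ltrDl ltr01.
Qed.

Definition fcos (f : R -> R) (xi : R) : R := \int[mu]_(x in [set: R]) (f x * cos (x * xi)).

Definition fsin (f : R -> R) (xi : R) : R := \int[mu]_(x in [set: R]) (f x * sin (x * xi)).

Lemma continuous_cosMl z : continuous (fun x : R => cos (x * z)).
Proof.
move=> x; apply: continuous_comp; last exact: continuous_cos.
by apply: cvgM => //; exact: cvg_cst.
Qed.

Lemma continuous_sinM z : continuous (fun x : R => sin (z * x)).
Proof.
move=> x; apply: continuous_comp; last exact: continuous_sin.
by apply: cvgM => //; exact: cvg_cst.
Qed.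

Lemma continuous_sinMl z : continuous (fun x : R => sin (x * z)).
Proof.
move=> x; apply: continuous_comp; last exact: continuous_sin.
by apply: cvgM => //; exact: cvg_cst.
Qed.

Lemma continuous_fcos f : integ f -> continuous (fcos f).
Proof.
move=> intf; apply: (@continuous_Rintegral_bounded _ _ 1) => //.
- by move=> xi; apply: continuous_measurable_fun; exact: continuous_cosMl.
- by move=> x; exact: continuous_cosM.
- by move=> xi x; exact: cos_norm_le1.
Qed.

Lemma continuous_fsin f : integ f -> continuous (fsin f).
Proof.
move=> intf; apply: (@continuous_Rintegral_bounded _ _ 1) => //.
- by move=> xi; apply: continuous_measurable_fun; exact: continuous_sinMl.
- by move=> x; exact: continuous_sinM.
- by move=> xi x; exact: sin_norm_le1.
Qed.

Lemma Rintegral_bounded_le (f h : R -> R) (M : R) : integ f -> measurable_fun [set: R] h ->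
  (forall x, `|h x| <= M) ->
  `|\int[mu]_(x in [set: R]) (f x * h x)| <= M * \int[mu]_(x in [set: R]) `|f x|.
Proof.
move=> intf mh hM; have intfh := integM_bounded intf mh hM.
have intnf : integ (fun x => `|f x|) by exact: integrable_norm intf.
rewrite (le_trans (le_normr_Rintegral _ _))// -RintegralZl//.
apply: le_Rintegral => //; first exact: integrable_norm intfh.
  by apply: integZ.
by move=> x _; rewrite normrM mulrC ler_wpM2r.
Qed.

Lemma integ_cosM (f : R -> R) xi : integ f -> integ (fun x => f x * cos (x * xi)).
Proof.
move=> intf; apply: (integM_bounded intf _ (fun x => cos_norm_le1 (x * xi))).
by apply: continuous_measurable_fun; exact: continuous_cosMl.
Qed.

Lemma integ_sinM (f : R -> R) xi : integ f -> integ (fun x => f x * sin (x * xi)).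
Proof.
move=> intf; apply: (integM_bounded intf _ (fun x => sin_norm_le1 (x * xi))).
by apply: continuous_measurable_fun; exact: continuous_sinMl.
Qed.

Lemma fcos_bounded f xi : integ f -> `|fcos f xi| <= \int[mu]_(x in [set: R]) `|f x|.
Proof.
move=> intf; rewrite -[leRHS]mul1r; apply: Rintegral_bounded_le => //.
  by apply: continuous_measurable_fun; exact: continuous_cosMl.
by move=> x; exact: cos_norm_le1.
Qed.

Lemma fsin_bounded f xi : integ f -> `|fsin f xi| <= \int[mu]_(x in [set: R]) `|f x|.
Proof.
move=> intf; rewrite -[leRHS]mul1r; apply: Rintegral_bounded_le => //.
  by apply: continuous_measurable_fun; exact: continuous_sinMl.
by move=> x; exact: sin_norm_le1.
Qed.

Lemma fcos_shift k x xi : integ k ->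
  \int[mu]_(y in [set: R]) (k y * cos ((x - y) * xi)) =
  cos (x * xi) * fcos k xi + sin (x * xi) * fsin k xi.
Proof.
move=> intk; rewrite /fcos /fsin -!RintegralZl//; last 2 first.
- exact: integ_sinM.
- exact: integ_cosM.
rewrite -RintegralD//; last 2 first.
- by apply: integZ; exact: integ_cosM.
- by apply: integZ; exact: integ_sinM.
by apply: eq_Rintegral => y _; rewrite mulrBl cosB; ring.
Qed.

Lemma fourier_pairing f k xi : integ f -> integ k ->
  fcos f xi * fcos k xi + fsin f xi * fsin k xi =
  \int[mu]_(x in [set: R]) (f x * \int[mu]_(y in [set: R]) (k y * cos ((x - y) * xi))).
Proof.
move=> intf intk; under eq_Rintegral do rewrite fcos_shift// mulrDr !mulrA.
rewrite RintegralD//.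
- by rewrite !RintegralZr//; [exact: integ_sinM|exact: integ_cosM].
- by under [in X in _.-integrable _ X]eq_fun do rewrite mulrC; apply: integZ; exact: integ_cosM.
- by under [in X in _.-integrable _ X]eq_fun do rewrite mulrC; apply: integZ; exact: integ_sinM.
Qed.

(** The frequency integral is moved inside twice, first past x and then past y. What remains
    innermost is the Abel mean of cos((x - y) xi), which is the Poisson kernel. *)
Lemma poisson_pairing e f k : 0 < e -> integ f -> integ k ->
  \int[mu]_(xi in [set: R]) (half_expR e xi *
    (fcos f xi * fcos k xi + fsin f xi * fsin k xi)) =
  \int[mu]_(x in [set: R]) (f x * \int[mu]_(y in [set: R]) (k y * poisson e (x - y))).
Proof.
move=> e0 intf intk.
pose phi xi x := \int[mu]_(y in [set: R]) (k y * cos ((x - y) * xi)).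
set N := \int[mu]_(x in [set: R]) `|k x|.
transitivity (\int[mu]_(xi in [set: R])
    (half_expR e xi * \int[mu]_(x in [set: R]) (f x * phi xi x))).
  by apply: eq_Rintegral => xi _; rewrite fourier_pairing.
have mcosM (h : R * R -> R) : measurable_fun [set: R * R] h ->
    measurable_fun [set: R * R] (fun p => cos (h p)).
  by apply: measurableT_comp; apply: continuous_measurable_fun; exact: continuous_cos.
have msinM (h : R * R -> R) : measurable_fun [set: R * R] h ->
    measurable_fun [set: R * R] (fun p => sin (h p)).
  by apply: measurableT_comp; apply: continuous_measurable_fun; exact: continuous_sin.
have phiN xi x : `|phi xi x| <= 1 * N.
  apply: Rintegral_bounded_le => //.
    apply: (continuous_measurable_fun (f := fun y => cos ((x - y) * xi))) => y.
    apply: (@continuous_comp _ _ _ (fun y => (x - y) * xi)); last exact: continuous_cos.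
    apply: cvgM; last exact: cvg_cst.
    by apply: cvgB; [exact: cvg_cst|exact: cvg_id].
  by move=> y; exact: cos_norm_le1.
have mphi : measurable_fun [set: R * R] (fun p => phi p.1 p.2).
  (* The addition formula separates x from the integration in y, so joint measurability follows from
     that of functions of one variable and of products. *)
  rewrite /phi; under eq_fun do rewrite fcos_shift//.
  have mfc : measurable_fun [set: R] (fcos k).
    by apply: continuous_measurable_fun; exact: continuous_fcos.
  have mfs : measurable_fun [set: R] (fsin k).
    by apply: continuous_measurable_fun; exact: continuous_fsin.
  apply: measurable_funD; apply: measurable_funM.
  - by apply: mcosM; exact: measurable_funM.
  - exact: measurableT_comp.
  - by apply: msinM; exact: measurable_funM.
  - exact: measurableT_comp.
rewrite (Rintegral_Fubini (integ_half_expR e0) intf mphi phiN).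
apply: eq_Rintegral => x _; congr (_ * _).
have mcosB : measurable_fun [set: R * R] (fun p : R * R => cos ((x - p.2) * p.1)).
  by apply: mcosM; apply: measurable_funM => //; exact: measurable_funB.
rewrite /phi (Rintegral_Fubini (integ_half_expR e0) intk mcosB
  (fun xi y => cos_norm_le1 ((x - y) * xi))).
by apply: eq_Rintegral => y _; rewrite Rintegral_half_expR_cos.
Qed.

Lemma poisson_conv_bounded e k M x : 0 < e -> measurable_fun [set: R] k ->
  (forall y, `|k y| <= M) ->
  `|\int[mu]_(y in [set: R]) (k y * poisson e (x - y))| <= M * pi.
Proof.
move=> e0 mk kM.
under eq_Rintegral do rewrite mulrC.
apply: (le_trans (Rintegral_bounded_le (integ_poisson x e0) mk kM)).
rewrite ler_wpM2l ?(le_trans (normr_ge0 _) (kM 0))//.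
under eq_Rintegral do rewrite ger0_norm ?poisson_ge0//.
under eq_Rintegral do rewrite -[poisson _ _]mul1r.
rewrite (@Rintegral_poisson _ e (cst 1) 1)//; first last.
- by move=> y; rewrite normr1.
- by move=> y; exact: cvg_cst.
under eq_Rintegral do rewrite mul1r.
by rewrite /Rintegral integral_oneDsqrV.
Qed.

Lemma cvg_poisson_pairing f k M : integ f -> integ k -> continuous k ->
  (forall y, `|k y| <= M) ->
  \int[mu]_(x in [set: R]) (f x *
    \int[mu]_(y in [set: R]) (k y * poisson n.+1%:R^-1 (x - y))) @[n --> \oo] -->
  pi * \int[mu]_(x in [set: R]) (f x * k x).
Proof.
move=> intf intk ck kM.
have mk := continuous_measurable_fun ck.
have mf := integ_measurable intf.
have intfk : integ (fun x => f x * k x) by exact: integM_bounded kM.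
rewrite -RintegralZl//.
under [X in _ --> X]eq_Rintegral do rewrite mulrCA.
apply: (@Rintegral_dct _ _ _ (fun x => (M * pi) * `|f x|)).
- move=> n; apply: measurable_funM => //.
  apply: continuous_measurable_fun.
  apply: (@continuous_Rintegral_bounded _ _ n.+1%:R) => //.
  + by move=> x; apply: continuous_measurable_fun; exact: continuous_poissonB.
  + move=> y x; apply: (@continuous_comp _ _ _ (fun x => x - y)).
      by apply: cvgB; [exact: cvg_id|exact: cvg_cst].
    exact: continuous_poisson.
  + move=> x y; rewrite ger0_norm ?poisson_ge0//.
    by rewrite (le_trans (poisson_le _ _))// invrK.
- by apply: measurable_funM => //; exact: measurable_funM.
- by apply: aeW => x; apply: cvgM; [exact: cvg_cst|exact: cvg_poisson ck kM].
- by apply: integZ; exact: integrable_norm intf.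
- move=> n x; rewrite normrM mulrC ler_wpM2r//.
  exact: poisson_conv_bounded.
Qed.

(** At each frequency, ac + bd is at most half the sum of the four squares. The squares from k,
    still under the Abel weight, form the Poisson pairing of k with itself, whose limit is pi
    ||k||^2. *)
Lemma fourier_duality_continuous f k M : integ f -> integ k -> continuous k ->
  (forall y, `|k y| <= M) ->
  integ (fun xi => fcos f xi ^+ 2 + fsin f xi ^+ 2) ->
  pi * \int[mu]_(x in [set: R]) (f x * k x) <=
  2^-1 * \int[mu]_(xi in [set: R]) (fcos f xi ^+ 2 + fsin f xi ^+ 2) +
  2^-1 * (pi * \int[mu]_(x in [set: R]) (k x * k x)).
Proof.
move=> intf intk ck kM intF.
have cfk := cvg_poisson_pairing intf intk ck kM.
have ckk := cvg_poisson_pairing intk intk ck kM.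
set F := \int[mu]_(xi in [set: R]) (fcos f xi ^+ 2 + fsin f xi ^+ 2).
have crhs : 2^-1 * F + 2^-1 * \int[mu]_(x in [set: R]) (k x *
    \int[mu]_(y in [set: R]) (k y * poisson n.+1%:R^-1 (x - y))) @[n --> \oo] -->
    2^-1 * F + 2^-1 * (pi * \int[mu]_(x in [set: R]) (k x * k x)).
  by apply: cvgD; [exact: cvg_cst|apply: cvgM; [exact: cvg_cst|exact: ckk]].
apply: (ler_cvg_to cfk crhs); apply: nearW => n; rewrite /F.
have e0 : 0 < n.+1%:R^-1 :> R by [].
rewrite -!poisson_pairing//.
have intP g : integ g -> integ (fun xi => half_expR n.+1%:R^-1 xi *
    (fcos g xi * fcos k xi + fsin g xi * fsin k xi)).
  move=> intg; set N := \int[mu]_(x in [set: R]) `|k x|.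
  set N' := \int[mu]_(x in [set: R]) `|g x|.
  apply: (@integM_bounded _ _ _ (N' * N + N' * N)); first exact: integ_half_expR.
    apply: continuous_measurable_fun => xi; apply: cvgD; apply: cvgM.
    - exact: (continuous_fcos intg).
    - exact: (continuous_fcos intk).
    - exact: (continuous_fsin intg).
    - exact: (continuous_fsin intk).
  move=> xi; apply: (le_trans (ler_normD _ _)); rewrite !normrM; apply: lerD.
    exact: ler_pM (normr_ge0 _) (normr_ge0 _) (fcos_bounded xi intg) (fcos_bounded xi intk).
  exact: ler_pM (normr_ge0 _) (normr_ge0 _) (fsin_bounded xi intg) (fsin_bounded xi intk).
rewrite -!RintegralZl//; last exact: intP.
rewrite -RintegralD//; last 2 first.
- exact: integZ.
- by apply: integZ; exact: intP.
apply: le_Rintegral => //.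
- exact: intP.
- by apply: integD; apply: integZ => //; exact: intP.
move=> xi _.
(* The Abel weight is at most 1, so it may be dropped from the terms in f; it is
   kept on those in k, which it turns back into a Poisson pairing. *)
have := half_expR_le1 xi (ltW e0); have := half_expR_ge0 n.+1%:R^-1 xi.
move: (half_expR _ _) (fcos f xi) (fsin f xi) (fcos k xi) (fsin k xi) => h a b c d h0 h1.
have : h * (a ^+ 2 + b ^+ 2) <= a ^+ 2 + b ^+ 2.
  by rewrite ler_piMl// addr_ge0 ?sqr_ge0.
have : 0 <= h * ((a - c) ^+ 2 + (b - d) ^+ 2).
  by rewrite mulr_ge0// addr_ge0 ?sqr_ge0.
nra.
Qed.

End fourier_pairing.

(** * Box averages, and duality against bounded functions of compact support *)

Section box_average.
Context {R : realType}.
Local Notation mu := (@lebesgue_measure R).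
Local Notation integ f := (mu.-integrable [set: R] (EFin \o f)).
Implicit Types (f g : R -> R) (M N x y d : R).

Lemma integ_indic_itv N : integ (\1_(`[- N, N]%classic : set R)).
Proof.
apply: integ_ge0_fin => //.
by rewrite integral_indic// setIT [X in (X < _)%E]lebesgue_measure_itv; case: ifP => //= _; rewrite -EFinB ltry.
Qed.

Lemma indic_itvE N x : \1_(`[- N, N]%classic : set R) x = (`|x| <= N)%R%:R :> R.
Proof. by rewrite indicE mem_setE in_itv/= -ler_norml. Qed.

Lemma integ_bounded_support g M N : measurable_fun [set: R] g ->
  (forall x, `|g x| <= M * \1_(`[- N, N]%classic : set R) x) -> integ g.
Proof.
by move=> mg gM; apply: integ_le mg gM _; apply: integZ; exact: integ_indic_itv.
Qed.

Definition primitive g x := \int[mu]_(t in `]-oo, x]) g t.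

Lemma integ_sub g (D : set R) : measurable D -> integ g -> mu.-integrable D (EFin \o g).
Proof. by move=> mD; apply: integrableS. Qed.

Lemma primitiveB g x y : x <= y -> integ g ->
  primitive g y - primitive g x = \int[mu]_(t in `]x, y]) g t.
Proof.
move=> xy intg; rewrite /primitive (@Rintegral_itvB _ _ -oo%O (BRight y))//.
exact: integ_sub.
Qed.

Lemma primitive_lipschitz_le g M x y : x <= y -> integ g -> (forall t, `|g t| <= M) ->
  `|primitive g y - primitive g x| <= M * (y - x).
Proof.
move=> xy intg gM; rewrite primitiveB//.
have intgD : mu.-integrable `]x, y] (EFin \o g) by exact: integ_sub.
apply: (le_trans (le_normr_Rintegral _ _)) => //.
have mxy : mu `]x, y]%classic = (y - x)%:E.
  rewrite lebesgue_measure_itv/= lte_fin; case: ltP => //= yx.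
  by have -> : x = y by [apply/eqP; rewrite eq_le xy]; rewrite subrr.
have <- : \int[mu]_(t in `]x, y]) M = M * (y - x).
  by rewrite Rintegral_cst// [X in fine X]mxy.
apply: le_Rintegral => //; first exact: integrable_norm intgD.
apply/integrableP; split; first exact: measurable_cst.
by rewrite integral_cst//= [X in (_ * X)%E]mxy -EFinM ltry.
Qed.

Lemma primitive_lipschitz g M x y : integ g -> (forall t, `|g t| <= M) ->
  `|primitive g y - primitive g x| <= M * `|y - x|.
Proof.
move=> intg gM; have [xy|/ltW yx] := leP x y.
  by rewrite (ger0_norm (_ : 0 <= y - x)) ?subr_ge0//; exact: primitive_lipschitz_le.
by rewrite distrC (distrC y) (ger0_norm (_ : 0 <= x - y)) ?subr_ge0//; exact: primitive_lipschitz_le.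
Qed.

Lemma continuous_primitive g M : integ g -> (forall t, `|g t| <= M) ->
  continuous (primitive g).
Proof.
move=> intg gM x; apply/cvgrPdist_le => e e0.
have M1 : 0 < `|M| + 1 by rewrite ltr_pwDr.
have : \forall y \near x, `|x - y| < e / (`|M| + 1).
  by apply: (@nbhsx_ballx _ R^o); rewrite divr_gt0.
apply: filterS => y xy; apply: (le_trans (primitive_lipschitz _ _ intg gM)).
apply: (@le_trans _ _ ((`|M| + 1) * `|x - y|)).
  by rewrite ler_wpM2r// (le_trans (ler_norm M))// lerDl.
by rewrite mulrC -ler_pdivlMr// ltW.
Qed.

(** The mean of g over the interval from x - d to x + d, written with a primitive so that continuity
    in x follows from the Lipschitz bound. *)
Definition box_average g d x := (primitive g (x + d) - primitive g (x - d)) / (d *+ 2).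

Lemma continuous_box_average g M d : integ g -> (forall t, `|g t| <= M) ->
  continuous (box_average g d).
Proof.
move=> intg gM x; have cg := continuous_primitive intg gM.
apply: cvgM; last exact: cvg_cst.
apply: cvgB.
  apply: (@continuous_comp _ _ _ (fun x => x + d)); last exact: cg.
  by apply: cvgD; [exact: cvg_id|exact: cvg_cst].
apply: (@continuous_comp _ _ _ (fun x => x - d)); last exact: cg.
by apply: cvgB; [exact: cvg_id|exact: cvg_cst].
Qed.

Lemma box_average_bounded g M N d x : 0 <= M -> 0 < d <= 1 -> integ g ->
  (forall x, `|g x| <= M * \1_(`[- N, N]%classic : set R) x) ->
  `|box_average g d x| <= M * \1_(`[- (N + 1), N + 1]%classic : set R) x.
Proof.
move=> M0 /andP[d0 d1] intg gMN; rewrite indic_itvE.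
have xd : x - d <= x + d by rewrite lerBlDr -addrA lerDl addr_ge0 ?ltW.
have gM t : `|g t| <= M.
  by rewrite (le_trans (gMN t))// ler_piMr// indicE lern1 leq_b1.
have d2 : 0 < d *+ 2 by rewrite mulrn_wgt0.
rewrite /box_average normrM normfV (gtr0_norm d2) ler_pdivrMr//.
(* Since d is at most 1, for |x| > N + 1 the averaging interval misses [-N, N] and the average
   vanishes. The support is thus controlled uniformly in d, as dominated convergence demands. *)
have [xN|xN] := leP `|x| (N + 1); last first.
  rewrite /= mulr0n mulr0 mul0r primitiveB// (_ : \int[mu]_(_ in _) _ = 0) ?normr0//.
  rewrite -[RHS](_ : \int[mu]_(t in `](x - d)%R, (x + d)%R]) cst 0 t = 0); last first.
    by rewrite Rintegral_cst// mul0r.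
  apply: eq_Rintegral => t; rewrite inE/= in_itv/= => /andP[xt tx].
  apply/eqP; rewrite -normr_le0 (le_trans (gMN t))// indic_itvE.
  suff -> : (`|t| <= N) = false by rewrite /= mulr0n mulr0.
  apply/negbTE; rewrite -ltNge.
  have : `|x| <= `|t| + 1.
    rewrite -(subrK t x) addrC (le_trans (ler_normD _ _))// lerD2l.
    by rewrite (le_trans _ d1)// ler_norml; apply/andP; split; lra.
  lra.
rewrite mulr1 (le_trans (primitive_lipschitz_le xd intg gM))//.
by rewrite (_ : x + d - (x - d) = d *+ 2)//; ring.
Qed.

Lemma box_average_ae g : integ g ->
  {ae mu, forall x, box_average g n.+1%:R^-1 x @[n --> \oo] --> g x}.
Proof.
move=> intg.
have locg : locally_integrable setT g by apply: open_integrable_locally => //; exact: openT.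
apply: ae_imp (lebesgue_differentiation locg) => x lx.
pose E (x : R) (n : nat) : set R := ball x n.+1%:R^-1.
have mE y n : mu (E y n) = (n.+1%:R^-1 *+ 2)%:E by rewrite /E lebesgue_measure_ball.
(* The shrinking sets are the balls themselves, so the comparison constant is 1. *)
have nE y : nicely_shrinking y (E y).
  split; first by move=> n; exact: measurable_ball.
  exists (1, fun n => PosNum (ltac:(by []) : 0 < n.+1%:R^-1 :> R)); split => //=.
  - exact: cvg_harmonic.
  - by move=> n.
  - by move=> n; rewrite mul1e.
have := nice_lebesgue_differentiation nE locg lx => /fine_cvg.
apply: cvg_trans; apply: near_eq_cvg; apply: nearW => n /=.
rewrite mE inver mulrn_eq0/= invr_eq0 pnatr_eq0/=.
have xd : x - n.+1%:R^-1 <= x + n.+1%:R^-1.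
  by rewrite lerBlDr -addrA lerDl addr_ge0.
rewrite /box_average primitiveB// -Rintegral_itv_bndo_bndc; last exact: integ_sub.
rewrite /E ball_itv mulrC /Rintegral fineM//.
by apply: integrable_fin_num => //; exact: integ_sub.
Qed.

(** Continuity of the test function is removed by box averages: they converge almost everywhere with
    a common bound and a common bounded support, so both sides pass to the limit. *)
Lemma fourier_duality f g M N : 0 <= M -> integ f -> measurable_fun [set: R] g ->
  (forall x, `|g x| <= M * \1_(`[- N, N]%classic : set R) x) ->
  integ (fun xi => fcos f xi ^+ 2 + fsin f xi ^+ 2) ->
  pi * \int[mu]_(x in [set: R]) (f x * g x) <=
  2^-1 * \int[mu]_(xi in [set: R]) (fcos f xi ^+ 2 + fsin f xi ^+ 2) +
  2^-1 * (pi * \int[mu]_(x in [set: R]) (g x * g x)).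
Proof.
move=> M0 intf mg gMN intF.
have intg := integ_bounded_support mg gMN.
pose k n := box_average g n.+1%:R^-1.
have gM t : `|g t| <= `|M|.
  rewrite (le_trans (gMN t))// (le_trans (ler_norm _))// normrM ler_piMr//.
  by rewrite indic_itvE ger0_norm// lern1 leq_b1.
have kMN n x : `|k n x| <= M * \1_(`[- (N + 1), N + 1]%classic : set R) x.
  by apply: box_average_bounded => //; rewrite invr_gt0 ltr0n/= invf_le1// ler1n.
have ck n : continuous (k n) by exact: continuous_box_average intg gM.
have mk n : measurable_fun [set: R] (k n) by exact: continuous_measurable_fun.
have kM n t : `|k n t| <= `|M|.
  rewrite (le_trans (kMN n t))// (le_trans (ler_norm _))// normrM ler_piMr//.
  by rewrite indic_itvE ger0_norm// lern1 leq_b1.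
have kg := box_average_ae intg.
have mf := integ_measurable intf.
have lhs : pi * \int[mu]_(x in [set: R]) (f x * k n x) @[n --> \oo] -->
    pi * \int[mu]_(x in [set: R]) (f x * g x).
  apply: cvgM; first exact: cvg_cst.
  apply: (@Rintegral_dct _ _ _ (fun x => `|M| * `|f x|)).
  - by move=> n; exact: measurable_funM.
  - exact: measurable_funM.
  - by apply: ae_imp kg => x kgx; apply: cvgM; [exact: cvg_cst|exact: kgx].
  - by apply: integZ; exact: integrable_norm intf.
  - by move=> n x; rewrite normrM mulrC ler_wpM2r.
have kk : \int[mu]_(x in [set: R]) (k n x * k n x) @[n --> \oo] -->
    \int[mu]_(x in [set: R]) (g x * g x).
  apply: (@Rintegral_dct _ _ _ (fun x => `|M| * (M * \1_(`[- (N + 1), N + 1]%classic : set R) x))).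
  - by move=> n; exact: measurable_funM.
  - exact: measurable_funM.
  - by apply: ae_imp kg => x kgx; apply: cvgM; exact: kgx.
  - by apply: integZ; apply: integZ; exact: integ_indic_itv.
  - by move=> n x; rewrite normrM ler_pM.
set F := \int[mu]_(xi in [set: R]) (fcos f xi ^+ 2 + fsin f xi ^+ 2).
have rhs : 2^-1 * F + 2^-1 * (pi * \int[mu]_(x in [set: R]) (k n x * k n x)) @[n --> \oo] -->
    2^-1 * F + 2^-1 * (pi * \int[mu]_(x in [set: R]) (g x * g x)).
  apply: cvgD; first exact: cvg_cst.
  apply: cvgM; first exact: cvg_cst.
  by apply: cvgM; first exact: cvg_cst.
apply: (ler_cvg_to lhs rhs); apply: nearW => n.
apply: fourier_duality_continuous => //.
exact: integ_bounded_support (mk n) (kMN n).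
Qed.

End box_average.

(** * From the transform back to the L^2 norm *)

Section plancherel.
Context {R : realType}.
Local Notation mu := (@lebesgue_measure R).
Local Notation integ f := (mu.-integrable [set: R] (EFin \o f)).
Implicit Types (f g h a b : R -> R) (M N x y d s : R).

Lemma L2_measurable f : L2 f -> measurable_fun [set: R] f.
Proof. by move=> /sub_Lfun_mfun; rewrite inE. Qed.

Lemma L2_integ_sqr f : L2 f -> integ (fun x => f x ^+ 2).
Proof. exact: Lfun2_integrable_sqr. Qed.

Lemma L2normE f : L2norm f = sqrte (\int[mu]_x (f x ^+ 2)%:E)%E.
Proof.
rewrite /L2norm unlock poweR12_sqrt; last by apply: integral_ge0 => x _; exact: poweR_ge0.
congr (sqrte _); apply: eq_integral => x _ /=.
by rewrite powR_mulrn// real_normK// num_real.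
Qed.

Lemma sqrte_lt (x : \bar R) d : (0 <= x)%E -> 0 < d ->
  (sqrte x < d%:E)%E -> (x <= (d ^+ 2)%:E)%E.
Proof.
move=> x0 d0 xd; rewrite -lee_sqrt ?lee_fin ?sqr_ge0//.
by rewrite EFin_expe sqrte_sqr/= gtr0_norm// ltW.
Qed.

Lemma L2norm_lt f d : 0 < d -> (L2norm f < d%:E)%E ->
  (\int[mu]_x (f x ^+ 2)%:E <= (d ^+ 2)%:E)%E.
Proof.
move=> d0; rewrite L2normE => /sqrte_lt; apply => //.
by apply: integral_ge0 => x _; rewrite lee_fin sqr_ge0.
Qed.

Lemma L2norm_lt_Rintegral f d : measurable_fun [set: R] f -> 0 < d ->
  (L2norm f < d%:E)%E ->
  integ (fun x => f x ^+ 2) /\ \int[mu]_(x in [set: R]) (f x ^+ 2) <= d ^+ 2.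
Proof.
move=> mf d0 /(L2norm_lt d0) fd.
have intf : integ (fun x => f x ^+ 2).
  apply: integ_ge0_fin; [exact: measurable_funX|by move=> x; exact: sqr_ge0|].
  exact: le_lt_trans fd (ltry _).
by split => //; rewrite -lee_fin /Rintegral fineK//; exact: integrable_fin_num intf.
Qed.

Lemma Rintegral_itv_patch f N (phi : R -> R) :
  \int[mu]_(x in `[- N, N]) (f x * phi x) =
  \int[mu]_(x in [set: R]) ((f \_ `[- N, N]) x * phi x).
Proof.
rewrite Rintegral_mkcond; apply: eq_Rintegral => x _.
by rewrite !patchE; case: ifP; rewrite ?mul0r.
Qed.

Lemma integ_patch_L2 f N : L2 f -> integ (f \_ `[- N, N]).
Proof.
move=> L2f; have mf := L2_measurable L2f.
(* On the interval, |f| <= f^2 + 1. *)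
apply: (@integ_le _ _ (fun x => f x ^+ 2 + \1_(`[- N, N]%classic : set R) x)).
- by apply/(measurable_restrictT _ _).1 => //; exact: measurable_funTS.
- move=> x; rewrite patchE indicE; case: ifP => _ /=.
    have := sqr_ge0 (`|f x| - 1); rewrite -(real_normK (num_real (f x))) mulr1n.
    by have := normr_ge0 (f x); nra.
  by rewrite normr0 mulr0n addr0 sqr_ge0.
- by apply: integD; [exact: L2_integ_sqr|exact: integ_indic_itv].
Qed.

(** Large values are replaced by 0 instead of being clamped, so that the product with f is exactly
    the square of the truncation. *)
Definition truncation f N x := if (`|x| <= N) && (`|f x| <= N) then f x else 0.

Lemma truncation_bounded f N x : 0 <= N ->
  `|truncation f N x| <= N * \1_(`[- N, N]%classic : set R) x.
Proof.
move=> N0; rewrite indic_itvE /truncation; case: (`|x| <= N) => /=.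
  by rewrite mulr1n mulr1; case: ifP => //; rewrite normr0.
by rewrite normr0 mulr0n mulr0.
Qed.

Lemma measurable_truncation f N : measurable_fun [set: R] f ->
  measurable_fun [set: R] (truncation f N).
Proof.
move=> mf; apply: measurable_fun_if => //.
- apply: measurable_and.
    by apply: measurable_fun_ler => //; exact: measurableT_comp.
  by apply: measurable_fun_ler => //; exact: measurableT_comp.
- exact: measurable_funTS.
Qed.

Lemma truncationM f N n x : N <= n ->
  (f \_ `[- n, n]) x * truncation f N x = truncation f N x ^+ 2.
Proof.
move=> Nn; rewrite /truncation; case: ifP => [/andP[xN _]|_].
  by rewrite patchE mem_setE in_itv/= -ler_norml (le_trans xN Nn) expr2.
by rewrite mulr0 expr0n.
Qed.

(** Let f_n be f restricted to [-n, n] and k the truncation. For n >= N, f_n k = k^2, and duality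
    gives pi ||k||^2 <= ||\hat f_n||^2. The transform of f_n is L^2-close to (a, b), and the
    triangle inequality for squares costs the factor 2. *)
Lemma truncation_fourier_le f a b N : 0 <= N -> is_fourier f a b ->
  pi * \int[mu]_(x in [set: R]) (truncation f N x ^+ 2) <=
  2 * \int[mu]_(xi in [set: R]) (a xi ^+ 2 + b xi ^+ 2).
Proof.
move=> N0 [L2f L2a L2b ca cb]; apply/ler_addgt0Pr => e e0.
(* The two errors, for cosine and sine, contribute 2 (d^2 + d^2) = e. *)
pose d := Num.sqrt e / 2.
have d0 : 0 < d by rewrite divr_gt0// sqrtr_gt0.
have d2 : d ^+ 2 = e / 4.
  by rewrite expr_div_n sqr_sqrtr ?ltW// -natrX.
pose fn (n : nat) := f \_ `[- n%:R, n%:R].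
have cvgE (phi : R -> R -> R) c : (fun n : nat => L2norm (fun xi =>
      \int[mu]_(x in `[- n%:R, n%:R]) (f x * phi x xi) - c xi)) @ \oo --> 0%E ->
    \forall n \near \oo, Order.lt (L2norm (fun xi =>
      \int[mu]_(x in [set: R]) (fn n x * phi x xi) - c xi)) d%:E.
  have U : nbhs (0%:E : \bar R) [set y : \bar R | (y < d%:E)%E].
    apply: open_nbhs_nbhs; split; first exact: open_ereal_lt_ereal.
    by rewrite /= lte_fin.
  move=> /(_ _ U) cv; apply: (@filterS _ \oo _ _ _ _ cv) => n /=.
  suff -> : (fun xi => \int[mu]_(x in `[- n%:R, n%:R]) (f x * phi x xi) - c xi) =
    (fun xi => \int[mu]_(x in [set: R]) (fn n x * phi x xi) - c xi) by [].
  by apply/funext => xi; rewrite Rintegral_itv_patch.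
have : \forall n \near \oo, N <= n%:R by exact: nbhs_infty_ger.
move/(filterI (filterI (cvgE _ _ ca) (cvgE _ _ cb))) => [n _ /(_ n (leqnn n))[[]]].
rewrite -/(fcos (fn n)) -/(fsin (fn n)) => an bn Nn.
have intfn : integ (fn n) by exact: integ_patch_L2.
have ma := L2_measurable L2a; have mb := L2_measurable L2b.
have mc : measurable_fun [set: R] (fcos (fn n)).
  by apply: continuous_measurable_fun; exact: continuous_fcos.
have ms : measurable_fun [set: R] (fsin (fn n)).
  by apply: continuous_measurable_fun; exact: continuous_fsin.
have [intA leA] := L2norm_lt_Rintegral (measurable_funB mc ma) d0 an.
have [intB leB] := L2norm_lt_Rintegral (measurable_funB ms mb) d0 bn.
have intab : integ (fun xi => a xi ^+ 2 + b xi ^+ 2).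
  by apply: integD; exact: L2_integ_sqr.
have intD := integD (integZ 2 (integD intA intB)) (integZ 2 intab).
have FD xi : fcos (fn n) xi ^+ 2 + fsin (fn n) xi ^+ 2 <=
    2 * ((fcos (fn n) xi - a xi) ^+ 2 + (fsin (fn n) xi - b xi) ^+ 2) +
    2 * (a xi ^+ 2 + b xi ^+ 2).
  move: (fcos _ _) (fsin _ _) (a xi) (b xi) => u v w z.
  (* Indeed 2 (u - w)^2 + 2 w^2 - u^2 = (u - 2w)^2. *)
  by have := sqr_ge0 (u - 2 * w); have := sqr_ge0 (v - 2 * z); nra.
(* Square integrability of the transform of f_n, which duality takes as a hypothesis, is inherited
   from a and b through the closeness just obtained. *)
have intF : integ (fun xi => fcos (fn n) xi ^+ 2 + fsin (fn n) xi ^+ 2).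
  apply: integ_le _ _ intD.
    by apply: measurable_funD; exact: measurable_funX.
  by move=> xi; rewrite ger0_norm ?addr_ge0 ?sqr_ge0.
have := fourier_duality N0 intfn (measurable_truncation N (L2_measurable L2f))
  (fun x => truncation_bounded f x N0) intF.
under eq_Rintegral do rewrite truncationM//.
under [X in _ <= _ + _ * (_ * X) -> _]eq_Rintegral do rewrite -expr2.
have leFD := le_Rintegral measurableT intF intD (fun xi _ => FD xi).
rewrite (RintegralD measurableT (integZ 2 (integD intA intB)) (integZ 2 intab)) in leFD.
rewrite (RintegralZl 2 measurableT (integD intA intB)) in leFD.
rewrite (RintegralZl 2 measurableT intab) in leFD.
rewrite (RintegralD measurableT intA intB) in leFD.
move: leFD leA leB; rewrite d2.
move: (Rintegral _ _ _) (Rintegral _ _ _) (Rintegral _ _ _) (Rintegral _ _ _) (Rintegral _ _ _).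
move=> u v w z t; lra.
Qed.

Lemma sqr_truncation_le f N x : truncation f N x ^+ 2 <= f x ^+ 2.
Proof. by rewrite /truncation; case: ifP => //; rewrite expr0n sqr_ge0. Qed.

(* With the sharp constant, the factor [2] would be [2^-1]. *)
Lemma fourier_ge_L2 f a b : is_fourier f a b ->
  pi * \int[mu]_(x in [set: R]) (f x ^+ 2) <=
  2 * \int[mu]_(xi in [set: R]) (a xi ^+ 2 + b xi ^+ 2).
Proof.
move=> fab; have [L2f _ _ _ _] := fab; have mf := L2_measurable L2f.
have cv : pi * \int[mu]_(x in [set: R]) (truncation f n%:R x ^+ 2) @[n --> \oo] -->
    pi * \int[mu]_(x in [set: R]) (f x ^+ 2).
  apply: cvgM; first exact: cvg_cst.
  apply: (@Rintegral_dct _ _ _ (fun x => f x ^+ 2)).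
  - by move=> n; apply: measurable_funX; exact: measurable_truncation.
  - exact: measurable_funX.
  - apply: aeW => x; apply: cvg_near_cst.
    have : \forall n \near \oo, `|x| + `|f x| <= n%:R by exact: nbhs_infty_ger.
    apply: filterS => n xn; rewrite /truncation.
    by rewrite !(le_trans _ xn) ?lerDl ?lerDr.
  - exact: L2_integ_sqr.
  - by move=> n x; rewrite ger0_norm ?sqr_ge0//; exact: sqr_truncation_le.
apply: (ler_cvg_to cv (cvg_cst _)); apply: nearW => n.
exact: truncation_fourier_le.
Qed.

(** A finite infimum supplies an actual transform. As s >= 0 the weight is at least 1, so its
    squared norm is at most 2 pi d^2; the lower Plancherel bound doubles this and divides by pi,
    whence 4 d^2. *)
Lemma Hs_norm_lt_L2 s f d : 0 <= s -> 0 < d -> (Hs_norm s f < d%:E)%E ->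
  L2 f /\ \int[mu]_(x in [set: R]) (f x ^+ 2) <= 4 * d ^+ 2.
Proof.
move=> s0 d0 /ereal_inf_lt[r [a [b [fab ->]]]]; have [L2f L2a L2b _ _] := fab.
have ma := L2_measurable L2a; have mb := L2_measurable L2b.
set I := (\int[mu]_xi _)%E => Id; split => //.
have I0 : (0 <= I)%E.
  apply: integral_ge0 => xi _; rewrite lee_fin mulr_ge0 ?powR_ge0//.
  by rewrite addr_ge0 ?sqr_ge0.
have pi2 : 0 < (2 * pi)^-1 :> R by rewrite invr_gt0 mulr_gt0// pi_gt0.
have cI0 : (0 <= (2 * pi)^-1%:E * I)%E by rewrite mule_ge0// lee_fin ltW.
move: Id; rewrite poweR12_sqrt// => /(sqrte_lt cI0 d0) Id.
have intab : integ (fun xi => a xi ^+ 2 + b xi ^+ 2).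
  by apply: integD; exact: L2_integ_sqr.
have JI : ((\int[mu]_(xi in [set: R]) (a xi ^+ 2 + b xi ^+ 2))%:E <= I)%E.
  rewrite /Rintegral fineK; last exact: integrable_fin_num intab.
  apply: ge0_le_integral => //.
  - by move=> xi _; rewrite lee_fin addr_ge0 ?sqr_ge0.
  - exact: (measurable_int mu).
  - apply/measurable_EFinP; apply: measurable_funM.
      apply: (measurableT_comp (measurable_powR s)).
      by apply: measurable_funD => //; exact: measurable_funX.
    by apply: measurable_funD; exact: measurable_funX.
  - move=> xi _; rewrite lee_fin ler_peMl ?addr_ge0 ?sqr_ge0//.
    apply: (@le_trans _ _ (1 `^ s)); first by rewrite powR1.
    rewrite ge0_ler_powR// ?nnegrE ?lerDl ?sqr_ge0//.
    by rewrite addr_ge0 ?sqr_ge0.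
have J2 : \int[mu]_(xi in [set: R]) (a xi ^+ 2 + b xi ^+ 2) <= 2 * pi * d ^+ 2.
  rewrite mulrC -ler_pdivrMr ?mulr_gt0 ?pi_gt0// mulrC -lee_fin EFinM.
  by apply: le_trans Id; apply: lee_wpmul2l => //; rewrite lee_fin ltW.
rewrite -(ler_pM2l (pi_gt0 R)); apply: (le_trans (fourier_ge_L2 fab)).
by move: J2; move: (Rintegral _ _ _) => J; lra.
Qed.

End plancherel.

(** * The BBM nonlinearity *)

Section bbm_kernel.
Context {R : realType}.
Local Notation mu := (@lebesgue_measure R).
Local Notation integ f := (mu.-integrable [set: R] (EFin \o f)).
Implicit Types (f g h u : R -> R) (x y z t : R).

Lemma continuous_expRNnorm : continuous (fun z : R => expR (- `|z|)).
Proof.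
move=> z; apply: (@continuous_comp _ _ _ (fun z => - `|z|)); last exact: continuous_expR.
by apply: cvgN; exact: norm_continuous.
Qed.

Lemma expRNnorm_le1 z : expR (- `|z|) <= 1.
Proof. by rewrite -expR0 ler_expR oppr_le0. Qed.

(** With r = |z|, e^r = (e^{r/2})^2 >= (1 + r/2)^2 >= (1 + r^2)/4. *)
Lemma expRNnorm_le z : expR (- `|z|) <= 4 * (oneDsqr z)^-1.
Proof.
have oz : 0 < oneDsqr z by rewrite (lt_le_trans _ (oneDsqr_ge1 z)).
rewrite expRN -ler_pdivrMr ?invr_gt0// invrK mulrC ler_pdivrMr ?expR_gt0//.
have -> : `|z| = `|z| / 2 + `|z| / 2 by field.
have := expR_ge1Dx (`|z| / 2); have := normr_ge0 z.
rewrite expRD /oneDsqr -(real_normK (num_real z)).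
by move: `|z| (expR _) => r e; nra.
Qed.

Lemma integ_expRNnorm : integ (fun z : R => expR (- `|z|)).
Proof.
apply: (@integ_le _ _ (fun z => 4 * (oneDsqr z)^-1)).
- by apply: continuous_measurable_fun; exact: continuous_expRNnorm.
- by move=> z; rewrite gtr0_norm ?expR_gt0//; exact: expRNnorm_le.
- by apply: integZ; exact: integ_oneDsqrV.
Qed.

Lemma integ_expRNnormB x : integ (fun y => expR (- `|x - y|)) /\
  \int[mu]_(y in [set: R]) expR (- `|x - y|) = \int[mu]_(y in [set: R]) expR (- `|y|).
Proof.
have cE : continuous (fun y => expR (- `|x - y|)).
  move=> y; apply: (@continuous_comp _ _ _ (fun y => x - y) (fun z => expR (- `|z|))).
    by apply: cvgB; [exact: cvg_cst|exact: cvg_id].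
  exact: continuous_expRNnorm.
have H : (\int[mu]_y (expR (- `|x - y|))%:E = \int[mu]_y (expR (- `|y|))%:E)%E.
  rewrite (integral_ge0_affine x ltr01 cE (fun y => expR_ge0 _)).
  by apply: eq_integral => y _; rewrite mul1r mulr1 opprD addNKr normrN.
split; last by rewrite /Rintegral H.
apply: integ_ge0_fin; [exact: continuous_measurable_fun|by move=> y; exact: expR_ge0|].
rewrite H -ge0_fin_numE; last by apply: integral_ge0 => y _; rewrite lee_fin expR_ge0.
exact: (integrable_fin_num measurableT integ_expRNnorm).
Qed.

Lemma measurable_sgr : measurable_fun [set: R] (@Num.sg R).
Proof.
have -> : @Num.sg R = fun x => \1_(`]0, +oo[%classic : set R) x - \1_(`]-oo, 0[%classic : set R) x.
  apply/funext => x; rewrite !indicE !mem_setE !in_itv/= andbT.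
  by case: sgrP => x0; rewrite ?ltxx ?subrr// ?(lt_gtF x0) ?subr0 ?x0 ?sub0r.
by apply: measurable_funB; exact: measurable_indic.
Qed.

Lemma measurable_bbmK : measurable_fun [set: R] (@bbmK R).
Proof.
apply: measurable_funM.
  by apply: measurable_funM => //; exact: measurable_sgr.
by apply: continuous_measurable_fun; exact: continuous_expRNnorm.
Qed.

Lemma measurable_bbmKB x : measurable_fun [set: R] (fun y => bbmK (x - y)).
Proof.
apply: (measurableT_comp measurable_bbmK).
by apply: measurable_funB.
Qed.

Lemma bbmK_norm z : `|bbmK z| <= expR (- `|z|).
Proof.
rewrite /bbmK !normrM normrN (gtr0_norm (expR_gt0 _)) ler_piMl ?expR_ge0//.
by rewrite normr_sg ger0_norm//; case: (z != 0) => /=; lra.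
Qed.

Lemma continuous_bbmK z : z != 0 -> {for z, continuous (@bbmK R)}.
Proof.
move=> z0; apply: cvgM; last exact: continuous_expRNnorm.
apply: cvgM; first exact: cvg_cst.
apply: cvg_near_cst.
have : \forall y \near z, `|z - y| < `|z|.
  by apply: (@nbhsx_ballx _ R^o); rewrite normr_gt0.
apply: filterS => y; case: (ltgtP z 0) z0 => // zlt _.
  rewrite (ltr0_norm zlt) ltr_norml => /andP[zy yz].
  by rewrite !ltr0_sg//; lra.
rewrite (gtr0_norm zlt) ltr_norml => /andP[zy yz].
by rewrite !gtr0_sg//; lra.
Qed.

Definition flux u y := u y + u y ^+ 2 / 2.

Lemma measurable_flux u : measurable_fun [set: R] u -> measurable_fun [set: R] (flux u).
Proof.
move=> mu'; apply: measurable_funD => //; apply: measurable_funM => //.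
exact: measurable_funX.
Qed.

(** Splits the flux into a bounded part, integrable against e^{-|x - y|}, and a part integrable by
    itself. *)
Lemma flux_norm u y : `|flux u y| <= 1 + u y ^+ 2.
Proof. by rewrite /flux ler_norml; apply/andP; split; nra. Qed.

Lemma integ_expRNnorm_flux u x : L2 u ->
  integ (fun y => expR (- `|x - y|) * (1 + u y ^+ 2)).
Proof.
move=> L2u; have mu' := L2_measurable L2u; have [iE _] := integ_expRNnormB x.
have mE := integ_measurable iE.
apply: (integ_le _ _ (integD iE (L2_integ_sqr L2u))).
  by apply: measurable_funM => //; apply: measurable_funD => //; exact: measurable_funX.
move=> y; rewrite ger0_norm; last by rewrite mulr_ge0 ?expR_ge0 ?addr_ge0 ?sqr_ge0.
by rewrite mulrDr mulr1 lerD2l ler_piMl ?sqr_ge0 ?expRNnorm_le1.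
Qed.

Lemma integ_bbm_integrand u x : L2 u -> integ (fun y => bbmK (x - y) * flux u y).
Proof.
move=> L2u; apply: (integ_le _ _ (integ_expRNnorm_flux x L2u)).
  apply: measurable_funM; first exact: measurable_bbmKB.
  by apply: measurable_flux; exact: L2_measurable.
by move=> y; rewrite normrM ler_pM// ?bbmK_norm// flux_norm.
Qed.

(** K is discontinuous only at 0, so along a sequence tending to x the integrand converges off the
    null set y = x. *)
Lemma continuous_bbm_nonlinearity u : L2 u -> continuous (bbm_nonlinearity u).
Proof.
move=> L2u x; apply/(@cvg_nbhsP _ R^o) => v vx.
have [N _ vN] : \forall n \near \oo, `|x - v n| < 1 by exact: cvgr_dist_lt vx _ ltr01.
rewrite -(cvg_shiftn N).
have mflux := measurable_flux (L2_measurable L2u).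
(* Once v_n is within distance 1 of x, e^{-|v_n - y|} <= e e^{-|x - y|}; this is where the factor
   [expR 1] comes from. *)
apply: (@Rintegral_dct _ _ _ (fun y => expR 1 * (expR (- `|x - y|) * (1 + u y ^+ 2)))).
- by move=> n; apply: measurable_funM => //; exact: measurable_bbmKB.
- by apply: measurable_funM => //; exact: measurable_bbmKB.
- exists [set x]; split => //; first by rewrite lebesgue_measure_set1.
  move=> y /=; apply: contra_notP => /eqP yx.
  apply: cvgM; last exact: cvg_cst.
  have xy0 : x - y != 0 by rewrite subr_eq0 eq_sym.
  apply: (@cvg_comp _ _ _ (fun n => v (n + N)%N - y) (@bbmK R) _ (nbhs (x - y))).
    by apply: cvgB; [rewrite (cvg_shiftn N)|exact: cvg_cst].
  exact: continuous_bbmK.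
- by apply: integZ; exact: integ_expRNnorm_flux.
- move=> n y; rewrite normrM mulrA ler_pM// ?flux_norm//.
  apply: (le_trans (bbmK_norm _)); rewrite -expRD ler_expR.
  have := vN (n + N)%N (leq_addl _ _); rewrite /= => xv.
  have : `|x - y| <= `|x - v (n + N)%N| + `|v (n + N)%N - y|.
    by rewrite (le_trans _ (ler_normD _ _))// subrKA.
  lra.
Qed.

(** The difference is d (1 + u) + d^2/2 with d = v - u. The weight e in Young's inequality puts a
    small factor on the part in u, which is fixed, and the large factor 1/e on d^2, which can be
    made small afterwards. *)
Lemma flux_diff_norm u v y e : 0 < e ->
  `|flux v y - flux u y| <= e * (1 + u y ^+ 2) + (e^-1 + 1) * (v y - u y) ^+ 2.
Proof.
move=> e0; set d := v y - u y.
have -> : flux v y - flux u y = d * (1 + u y) + d ^+ 2 / 2.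
  by rewrite /flux /d; field.
(* The squares of d + e (1 + u)/2 and d - e (1 + u)/2, divided by e, give both signs; then (1 + u)^2
   <= 2 (1 + u^2). *)
have AM : `|d * (1 + u y)| <= e * (1 + u y ^+ 2) + e^-1 * d ^+ 2.
  have e1 : e * e^-1 = 1 by rewrite divff// gt_eqF.
  have ei : 0 < e^-1 by rewrite invr_gt0.
  have := sqr_ge0 (u y - 1).
  have := mulr_ge0 (ltW ei) (sqr_ge0 (d - e * (1 + u y) / 2)).
  have := mulr_ge0 (ltW ei) (sqr_ge0 (d + e * (1 + u y) / 2)).
  have -> : e^-1 * (d + e * (1 + u y) / 2) ^+ 2 =
    e^-1 * d ^+ 2 + d * (1 + u y) + e * (1 + u y) ^+ 2 / 4.
    by field; rewrite gt_eqF.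
  have -> : e^-1 * (d - e * (1 + u y) / 2) ^+ 2 =
    e^-1 * d ^+ 2 - d * (1 + u y) + e * (1 + u y) ^+ 2 / 4.
    by field; rewrite gt_eqF.
  have := mulr_ge0 (ltW e0) (sqr_ge0 (u y - 1)).
  have := mulr_ge0 (ltW e0) (sqr_ge0 (u y)).
  rewrite ler_norml; move: (e^-1 * d ^+ 2) => A ? ? ? ? ?.
  by apply/andP; split; nra.
apply: (le_trans (ler_normD _ _)).
have -> : e * (1 + u y ^+ 2) + (e^-1 + 1) * d ^+ 2 =
  e * (1 + u y ^+ 2) + e^-1 * d ^+ 2 + d ^+ 2 by ring.
apply: lerD => //.
rewrite normrM (ger0_norm (sqr_ge0 d)) gtr0_norm//; have := sqr_ge0 d.
by move: (d ^+ 2) => A; lra.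
Qed.

(** The majorant e^{-|x - y|} of the kernel enters through its mass against the constant 1 and
    through being at most 1 against the squares. Neither depends on x, so the bound is uniform in
    x. *)
Lemma bbm_nonlinearity_dist u v x e : L2 u -> L2 v -> L2 (v \- u) -> 0 < e ->
  `|bbm_nonlinearity v x - bbm_nonlinearity u x| <=
  e * (\int[mu]_(y in [set: R]) expR (- `|y|) + \int[mu]_(y in [set: R]) (u y ^+ 2)) +
  (e^-1 + 1) * \int[mu]_(y in [set: R]) ((v \- u) y ^+ 2).
Proof.
move=> L2u L2v L2d e0.
have iu := integ_bbm_integrand x L2u; have iv := integ_bbm_integrand x L2v.
have [iE <-] := integ_expRNnormB x.
have iu2 := L2_integ_sqr L2u; have id2 := L2_integ_sqr L2d.
rewrite /bbm_nonlinearity /conv -/(flux u) -/(flux v) -RintegralB//.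
apply: (le_trans (le_normr_Rintegral measurableT (integB iv iu))).
rewrite -RintegralD// -RintegralZl//; last exact: integD iE iu2.
rewrite -RintegralZl//.
have i1 := integZ e (integD iE iu2); have i2 := integZ (e^-1 + 1) id2.
rewrite -RintegralD//; apply: le_Rintegral => //.
- exact: integrable_norm (integB iv iu).
- exact: integD i1 i2.
move=> y _; rewrite -mulrBr normrM.
have k1 := bbmK_norm (x - y); have E1 := expRNnorm_le1 (x - y).
have E0 := expR_ge0 (- `|x - y|).
apply: (le_trans (ler_pM (normr_ge0 _) (normr_ge0 _) k1 (flux_diff_norm u v y e0))).
rewrite mulrDr; apply: lerD.
  rewrite mulrCA ler_wpM2l ?(ltW e0)// mulrDr mulr1 lerD2l.
  by rewrite ler_piMl ?sqr_ge0.
by rewrite ler_piMl// mulr_ge0 ?sqr_ge0// addr_ge0// invr_ge0 ltW.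
Qed.

End bbm_kernel.

(** * Existence and uniqueness of the pointwise time derivative *)

Section bbm_time_derivative.
Context {R : realType}.
Local Notation mu := (@lebesgue_measure R).
Local Notation integ f := (mu.-integrable [set: R] (EFin \o f)).
Implicit Types (x y t s T : R) (u : R -> R -> R).

Lemma bbm_nonlinearity_near s T u t e : 0 <= s -> C_Hs s T u -> t \in `[- T, T] -> 0 < e ->
  \forall t' \near within `[- T, T] (nbhs t), forall x,
    `|bbm_nonlinearity (u t') x - bbm_nonlinearity (u t) x| <= e.
Proof.
move=> s0 Cu tT e0; have [[L2u _] cu] := Cu _ tT.
set C := \int[mu]_(y in [set: R]) expR (- `|y|) + \int[mu]_(y in [set: R]) (u t y ^+ 2).
have C0 : 0 <= C by apply: addr_ge0; apply: Rintegral_ge0 => y _; rewrite ?expR_ge0 ?sqr_ge0.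
(* [h] is the Young weight: it makes the fixed part at most e/2, with C + 1 in place of C to keep
   the denominator positive. *)
pose h := e / (2 * (C + 1)).
have h0 : 0 < h by rewrite divr_gt0// mulr_gt0// ltr_wpDl.
have hC : h * C <= e / 2.
  have -> : h * C = e / 2 * (C / (C + 1)) by rewrite /h; field; rewrite gt_eqF// ltr_wpDl.
  rewrite ler_piMr ?divr_ge0 ?(ltW e0)//.
  by rewrite ler_pdivrMr ?ltr_wpDl// mul1r lerDl.
pose k := h^-1 + 1.
have k0 : 0 < k by rewrite ltr_wpDl// invr_ge0 ltW.
(* An H^s distance below d bounds the squared L^2 distance by 4 d^2, and k 4 d^2 = e/2. *)
pose d := Num.sqrt (e / (8 * k)).
have d0 : 0 < d by rewrite sqrtr_gt0 divr_gt0// mulr_gt0.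
have d2 : k * (4 * d ^+ 2) = e / 2.
  rewrite sqr_sqrtr; last by rewrite ltW// divr_gt0// mulr_gt0.
  by field; rewrite gt_eqF.
have U : nbhs (0%:E : \bar R) [set y : \bar R | (y < d%:E)%E].
  apply: open_nbhs_nbhs; split; first exact: open_ereal_lt_ereal.
  by rewrite /= lte_fin.
have {}cu := cu _ U.
have tT' : \forall t' \near within `[- T, T] (nbhs t), t' \in `[- T, T].
  exact: withinT.
apply: (@filterS2 _ (within `[- T, T] (nbhs t)) _ _ _ _ _ cu tT') => t' /= ut' t'T x.
have [L2d dd] := Hs_norm_lt_L2 s0 d0 ut'.
have [[L2u' _] _] := Cu _ t'T.
apply: (le_trans (bbm_nonlinearity_dist x L2u L2u' L2d h0)).
rewrite -/C (_ : e = e / 2 + e / 2); last by field.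
apply: lerD => //; rewrite -d2 ler_wpM2l// ltW//.
Qed.

Lemma bbm_nonlinearity_strip s T u : 0 <= s -> C_Hs s T u ->
  {within [set p : R * R | p.1 \in `[- T, T]],
    continuous (fun p : R * R => - bbm_nonlinearity (u p.1) p.2)}.
Proof.
move=> s0 Cu; apply/subspace_continuousP => -[t x] /= tT.
have [[L2u _] _] := Cu _ tT.
apply: cvgN; apply/cvgrPdist_le => e e0.
have e20 : 0 < e / 2 by rewrite divr_gt0.
have At := bbm_nonlinearity_near s0 Cu tT e20.
have /cvgrPdist_le/(_ _ e20) Ax :
    bbm_nonlinearity (u t) x' @[x' --> x] --> bbm_nonlinearity (u t) x.
  exact: continuous_bbm_nonlinearity.
(* A product neighbourhood works because the estimate in time is uniform in space: (t', x') is
   compared with (t, x') and then with (t, x). *)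
exists ([set t' | t' \in `[- T, T] -> forall x,
    `|bbm_nonlinearity (u t') x - bbm_nonlinearity (u t) x| <= e / 2],
  [set x' | `|bbm_nonlinearity (u t) x - bbm_nonlinearity (u t) x'| <= e / 2]).
  by split.
move=> [t' x'] /= [Ht Hx] t'T.
rewrite (_ : e = e / 2 + e / 2); last by field.
rewrite -(subrKA (bbm_nonlinearity (u t) x')) (le_trans (ler_normD _ _))// lerD//.
by rewrite distrC; exact: Ht.
Qed.

Lemma bbm_nonlinearity_time s T u x : 0 <= s -> C_Hs s T u ->
  {within `[- T, T], continuous (fun t => bbm_nonlinearity (u t) x)}.
Proof.
move=> s0 Cu; apply/subspace_continuousP => t tT.
apply/cvgrPdist_le => e e0.
apply: (filterS _ (bbm_nonlinearity_near s0 Cu tT e0)) => t' Ht.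
by rewrite distrC; exact: Ht.
Qed.

(** A single formula based at -T replaces the two branches of [int0], so that differentiation also
    covers t = 0, where they meet. *)
Lemma int0_primitive (g : R -> R) T t : t \in `[- T, T] -> mu.-integrable `[- T, T] (EFin \o g) ->
  int0 g t = \int[mu]_(x in `[- T, t]) g x - \int[mu]_(x in `[- T, 0]) g x.
Proof.
rewrite in_itv/= => /andP[Tt tT] intg; rewrite /int0.
have intS a b : - T <= a -> b <= T -> mu.-integrable `[a, b] (EFin \o g).
  move=> Ta bT; apply: integrableS intg => // y /=.
  by rewrite !in_itv/= => /andP[ay yb]; apply/andP; split; lra.
have intS' a b : - T <= a -> b <= T -> mu.-integrable `]a, b] (EFin \o g).
  by move=> Ta bT; apply: integrableS (intS a b Ta bT) => //; exact: subset_itv_oc_cc.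
have T0 : - T <= 0 by lra.
case: ifPn => t0.
  rewrite -Rintegral_itv_obnd_cbnd; last by apply: intS' => //; lra.
  rewrite -(@Rintegral_itvB _ g (BLeft (- T)) (BRight t) 0) ?bnd_simp//.
  exact: intS.
rewrite -ltNge in t0.
rewrite -Rintegral_itv_obnd_cbnd; last by apply: intS' => //; lra.
rewrite -(@Rintegral_itvB _ g (BLeft (- T)) (BRight 0) t) ?bnd_simp ?(ltW t0) ?opprB//.
by apply: intS => //; lra.
Qed.

Lemma is_derive_int0 (g : R -> R) T t : {within `[- T, T], continuous g} -> t \in `]- T, T[ ->
  is_derive t (1:R) (int0 g) (g t).
Proof.
move=> cg tT; have intg := continuous_compact_integrable (@segment_compact _ _ _) cg.
have /andP[Tt tT'] : - T < t < T by move: tT; rewrite in_itv.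
have cgt : {for t, continuous g}.
  have /subspace_continuousP/(_ t) := cg.
  rewrite within_interior; first by apply; exact: subset_itv_oo_cc.
  by rewrite interior_itv.
have [dF F'E] := continuous_FTC1_closed tT' intg Tt cgt.
have dP : is_derive t (1:R) (fun t => \int[mu]_(x in `[- T, t]) g x - \int[mu]_(x in `[- T, 0]) g x) (g t).
  rewrite -[X in is_derive _ _ _ X]subr0; apply: is_deriveB.
  by apply: (DeriveDef dF); rewrite -derive1E; exact: F'E.
apply: near_eq_is_derive dP.
have : \forall t' \near t, t' \in `]- T, T[ by exact: near_in_itvoo.
apply: filterS => t' t'T; rewrite (@int0_primitive g T)//.
by apply: subset_itv_oo_cc.
Qed.

(** The right-hand sides of the Duhamel identity, with one fixed function u0, serve as
    representatives: they are differentiable in time at every x. *)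
Lemma bbm_is_dt s T (u0 : R -> R) u : 0 <= s -> bbm_solution s T u0 u ->
  is_dt T u (fun t x => - bbm_nonlinearity (u t) x).
Proof.
move=> s0 [_ Cu uE]; split; first exact: bbm_nonlinearity_strip s0 Cu.
exists (fun t x => u0 x - int0 (fun t' => bbm_nonlinearity (u t') x) t); split.
  by move=> t tT; apply: ae_imp (uE t tT) => x ->.
move=> t x tT.
rewrite -[X in is_derive _ _ _ X]sub0r; apply: is_deriveB.
apply: is_derive_int0 tT; exact: bbm_nonlinearity_time s0 Cu.
Qed.

Lemma continuous_ae_eq0 (h : R -> R) : continuous h ->
  {ae mu, forall x, h x = 0} -> forall x, h x = 0.
Proof.
move=> ch h0 x; apply: contrapT => /eqP hx.
have [e /= e0 eh] : \forall y \near x, h y != 0.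
  have /cvgrPdist_lt/(_ `|h x|) := ch x; rewrite normr_gt0 => /(_ hx).
  by apply: filterS => y; apply: contraTneq => ->; rewrite subr0 ltxx.
have [A [mA A0 hA]] := h0.
have : (mu (ball x e) <= mu A)%E.
  apply: le_measure; rewrite ?inE//; first exact: measurable_ball.
  move=> y xy; apply: hA => /= hy0.
  by have := eh y xy; rewrite /= hy0 eqxx.
by rewrite A0 lebesgue_measure_ball ?(ltW e0)// lee_fin leNgt mulrn_wgt0.
Qed.

Lemma strip_continuous_section (v : R -> R -> R) T t :
  {within [set p : R * R | p.1 \in `[- T, T]],
    continuous (fun p : R * R => v p.1 p.2)} -> t \in `[- T, T] -> continuous (v t).
Proof.
move=> /subspace_continuousP cv tT x U Ux.
have [[A B] /= [tA xB] AB] := cv (t, x) tT U Ux.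
apply: filterS xB => y By.
by apply: (AB (t, y)) => //=; split => //=; exact: nbhs_singleton.
Qed.

(** The representatives V and W agree off a null set that varies with time. Off a countable union of
    these sets, V - W vanishes at t and at all t + r_n, so its derivative at t is 0; thus v = w
    almost everywhere at time t, and everywhere by continuity. *)
Lemma is_dt_unique T u (v w : R -> R -> R) t x : is_dt T u v -> is_dt T u w -> t \in `]- T, T[ ->
  v t x = w t x.
Proof.
move=> [cv [V [Vu dV]]] [cw [W [Wu dW]]] tT.
have /andP[Tt tT'] : - T < t < T by move: tT; rewrite in_itv.
have tTc : t \in `[- T, T] by exact: subset_itv_oo_cc.
apply/eqP; rewrite -subr_eq0; apply/eqP; move: x.
apply: (continuous_ae_eq0 (h := fun x => v t x - w t x)).
  by move=> x; apply: cvgB; exact: strip_continuous_section.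
have Tt0 : 0 < T - t by rewrite subr_gt0.
(* The factor T - t keeps t + r_n in [-T, T], with equality to T at n = 0. *)
pose r n : R := (T - t) * n.+1%:R^-1.
have r0 n : 0 < r n by rewrite mulr_gt0.
have rcvg : r n @[n --> \oo] --> (0:R).
  by rewrite -(mulr0 (T - t)); apply: cvgM; [exact: cvg_cst|exact: cvg_harmonic].
have rT n : t + r n \in `[- T, T].
  rewrite in_itv/=; apply/andP; split; first by rewrite (le_trans (ltW Tt))// lerDl ltW.
  by rewrite -lerBrDl ler_piMr ?(ltW Tt0)// invf_le1 ?ler1n.
have VW t' : t' \in `[- T, T] -> {ae mu, forall x, V t' x - W t' x = 0}.
  by move=> t'T; apply: ae_imp2 (Vu _ t'T) (Wu _ t'T) => x -> ->; rewrite subrr.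
have VWn := ae_foralln (fun n => VW _ (rT n)).
apply: ae_imp2 (VW t tTc) VWn => x VWt VWr.
have dVW : is_derive t (1:R) (fun t => V t x - W t x) (v t x - w t x).
  by apply: is_deriveB; [exact: dV|exact: dW].
have [der <-] := dVW.
have rd : r n @[n --> \oo] --> (0:R)^'.
  move=> U U0; apply: (@filterS _ \oo _ _ _ _ (rcvg _ U0)) => n /=; apply.
  by rewrite gt_eqF.
have := cvg_comp _ _ rd der.
set F := (F in F @ _ --> _ -> _).
have -> : F = cst 0.
  by apply/funext => n; rewrite /F /= [_ *: 1]mulr1 (addrC _ t) VWr VWt subrr scaler0.
by move=> H; apply: (cvg_unique _ H (cvg_cst _)); exact: Rhausdorff.
Qed.

End bbm_time_derivative.

(** * The sign argument *)

Section bbm_rigidity.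
Context {R : realType}.
Local Notation mu := (@lebesgue_measure R).
Local Notation integ f := (mu.-integrable [set: R] (EFin \o f)).
Implicit Types (x y a b : R) (f u : R -> R).

Lemma Rintegral_expRBy x : \int[mu]_(y in `[x, +oo[) expR (x - y) = 1.
Proof.
have cE : continuous (fun y => expR (x - y)).
  move=> y; apply: (@continuous_comp _ _ _ (fun y => x - y) expR); last exact: continuous_expR.
  by apply: cvgB; [exact: cvg_cst|exact: cvg_id].
have dF y : is_derive y (1:R) (fun y => - expR (x - y)) (expR (x - y)).
  by apply: is_derive_eq; rewrite /GRing.scale/=; ring.
rewrite (@Rintegral_ge0_continuous_FTC2y _ _ (fun y => - expR (x - y)) x 0).
- by rewrite subrr expR0 sub0r opprK.
- by move=> y _; exact: expR_ge0.
- exact: continuous_subspaceT.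
- rewrite -oppr0 -(mulr0 (expR x)); apply: cvgN.
  under eq_fun do rewrite expRD.
  by apply: cvgM; [exact: cvg_cst|exact: cvgr_expR].
- by move=> y _; have [] := dF y.
- by apply: cvg_at_right_filter; apply: cvgN; exact: cE.
- by move=> y _; rewrite derive1E; have [_ ->] := dF y.
Qed.

Lemma Rintegral_expRBNy x : \int[mu]_(y in `]-oo, x]) expR (y - x) = 1.
Proof.
have cE : continuous (fun y => expR (y - x)).
  move=> y; apply: (@continuous_comp _ _ _ (fun y => y - x) expR); last exact: continuous_expR.
  by apply: cvgB; [exact: cvg_id|exact: cvg_cst].
rewrite -[RHS](Rintegral_expRBy (- x)) /Rintegral; congr fine.
have := @ge0_integration_by_substitutionNy R (fun y => expR (y - x)) (- x).
rewrite opprK => ->; [|exact: continuous_subspaceT|by move=> y _; exact: expR_ge0].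
by apply: eq_integral => y _; rewrite /= addrC.
Qed.

Lemma integ_bbmKB x : integ (fun y => bbmK (x - y)).
Proof.
apply: (integ_le (measurable_bbmKB x) (fun y => bbmK_norm (x - y))).
exact: (integ_expRNnormB x).1.
Qed.

Lemma bbmK_gt0E (z : R) : 0 < z -> bbmK z = - (2^-1 * expR (- z)).
Proof. by move=> z0; rewrite /bbmK gtr0_sg// gtr0_norm// mulr1 mulNr. Qed.

Lemma bbmK_lt0E (z : R) : z < 0 -> bbmK z = 2^-1 * expR z.
Proof. by move=> z0; rewrite /bbmK ltr0_sg// ltr0_norm// opprK mulrN1 opprK. Qed.

Lemma Rintegral_bbmK x : \int[mu]_(y in [set: R]) bbmK (x - y) = 0.
Proof.
have -> : [set: R] = `]-oo, x] `|` `]x, +oo[.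
  by apply/seteqP; split => // y _ /=; rewrite !in_itv/= andbT; case: leP; [left|right].
have iK := integ_bbmKB x.
rewrite Rintegral_setU//; last 2 first.
- by apply: integ_sub => //; exact: measurableU.
- apply/disj_setPS => y /= []; rewrite !in_itv/= andbT => yx xy.
  by have := le_lt_trans yx xy; rewrite ltxx.
have iE : integ (fun y => expR (- `|x - y|)) by exact: (integ_expRNnormB x).1.
rewrite -Rintegral_itv_bndo_bndc; last exact: integ_sub.
have -> : \int[mu]_(y in `]-oo, x[) bbmK (x - y) =
    \int[mu]_(y in `]-oo, x[) (- 2^-1 * expR (- `|x - y|)).
  apply: eq_Rintegral => y; rewrite inE/= in_itv/= => yx.
  by rewrite bbmK_gt0E ?subr_gt0// gtr0_norm ?subr_gt0// mulNr.
have -> : \int[mu]_(y in `]x, +oo[) bbmK (x - y) =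
    \int[mu]_(y in `]x, +oo[) (2^-1 * expR (- `|x - y|)).
  apply: eq_Rintegral => y; rewrite inE/= in_itv/= andbT => xy.
  by rewrite bbmK_lt0E ?subr_lt0// ltr0_norm ?subr_lt0// opprK.
rewrite Rintegral_itv_bndo_bndc; last by apply: integ_sub => //; exact: integZ.
rewrite Rintegral_itv_obnd_cbnd; last by apply: integ_sub => //; exact: integZ.
rewrite !RintegralZl//; [|exact: integ_sub..].
have -> : \int[mu]_(y in `]-oo, x]) expR (- `|x - y|) = 1.
  rewrite -(Rintegral_expRBNy x); apply: eq_Rintegral => y.
  by rewrite inE/= in_itv/= => yx; rewrite ger0_norm ?subr_ge0// opprB.
have -> : \int[mu]_(y in `[x, +oo[) expR (- `|x - y|) = 1.
  rewrite -(Rintegral_expRBy x); apply: eq_Rintegral => y.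
  by rewrite inE/= in_itv/= andbT => xy; rewrite ler0_norm ?subr_le0// opprK.
by rewrite mulNr addNr.
Qed.

(** K increases on each open half-line and only jumps down at 0. Off [a, b] the points a - y < b - y
    lie on the same side of 0. *)
Lemma bbmK_diff_gt0 a b y : a < b -> (y < a) || (b < y) -> 0 < bbmK (b - y) - bbmK (a - y).
Proof.
rewrite subr_gt0 => ab /orP[ya|yb].
  have ya0 : 0 < a - y by rewrite subr_gt0.
  have yb0 : 0 < b - y by rewrite subr_gt0 (lt_trans ya).
  by rewrite !bbmK_gt0E// ltrN2 ltr_pM2l// ltr_expR; lra.
have yb0 : b - y < 0 by rewrite subr_lt0.
have ya0 : a - y < 0 by rewrite subr_lt0 (lt_trans ab).
by rewrite !bbmK_lt0E// ltr_pM2l// ltr_expR; lra.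
Qed.

Lemma integral_ae_ge0_eq0 (q : R -> R) : integ q -> {ae mu, forall y, 0 <= q y} ->
  \int[mu]_(y in [set: R]) q y <= 0 -> {ae mu, forall y, q y = 0}.
Proof.
move=> iq q0 intq0; have mq := integ_measurable iq.
have iq' : integ (fun y => `|q y|) by exact: integrable_norm iq.
have E : (\int[mu]_y `|(q y)%:E| = \int[mu]_y (q y)%:E)%E.
  apply: ae_eq_integral => //.
  - exact: (measurable_int mu iq').
  - exact/measurable_EFinP.
  - by apply: ae_imp q0 => y qy _; rewrite gee0_abs.
have E0 : (\int[mu]_y `|(q y)%:E| = 0)%E.
  apply/eqP; rewrite eq_le integral_ge0// andbT E.
  by rewrite -(fineK (integrable_fin_num measurableT iq)) lee_fin.
have mqE : measurable_fun [set: R] (EFin \o q) by exact/measurable_EFinP.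
have q00 := (ae_eq_integral_abs mu measurableT mqE).1 E0.
by apply: ae_imp q00 => y /(_ I) [].
Qed.

Lemma bbm_nonlinearity_rigidity f a b : L2 f -> a < b ->
  {ae mu, forall x, x \in `]a, b[ -> f x = -1} ->
  bbm_nonlinearity f b <= bbm_nonlinearity f a -> False.
Proof.
move=> L2f ab fab Nba.
pose J y := bbmK (b - y) - bbmK (a - y).
pose h y := (f y + 1) ^+ 2 / 2.
have hE y : h y = flux f y + 2^-1 by rewrite /h /flux; field.
have iF x := integ_bbm_integrand x L2f.
have iJ : integ J by apply: integB; exact: integ_bbmKB.
have iJF : integ (fun y => J y * flux f y).
  have := integB (iF b) (iF a).
  by under [in X in X -> _]eq_fun do rewrite -mulrBl.
pose q y := J y * h y.
have iq : integ q.
  rewrite (_ : q = (fun y => J y * flux f y + 2^-1 * J y)); last first.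
    by apply/funext => y; rewrite /q hE; ring.
  by apply: integD => //; exact: integZ.
(* Passing from the flux to [h] adds the constant 1/2, which is invisible to [J] because both
   translates of K have zero mean. *)
have qE : \int[mu]_(y in [set: R]) q y = bbm_nonlinearity f b - bbm_nonlinearity f a.
  rewrite /bbm_nonlinearity /conv -/(flux f) -RintegralB//.
  transitivity (\int[mu]_(y in [set: R]) (J y * flux f y + 2^-1 * J y)).
    by apply: eq_Rintegral => y _; rewrite /q hE; ring.
  rewrite (RintegralD measurableT iJF (integZ 2^-1 iJ)) RintegralZl//.
  rewrite (RintegralB measurableT (integ_bbmKB b) (integ_bbmKB a)).
  rewrite !Rintegral_bbmK subrr mulr0 addr0.
  by apply: eq_Rintegral => y _; rewrite mulrBl.
have h0 y : 0 <= h y by rewrite /h divr_ge0// sqr_ge0.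
have nab x : {ae mu, forall y, y <> x}.
  exists [set x]; split => //; first by rewrite lebesgue_measure_set1.
  by move=> y /= /contrapT.
(* The endpoints are discarded: the value of f is known only inside the open interval, and the sign
   of [J] only outside the closed one. *)
have hJ : {ae mu, forall y, h y = 0 \/ 0 < J y}.
  apply: ae_imp2 (nab a) (ae_imp2 _ (nab b) fab); last first.
    by move=> y; exact: pair.
  move=> y ya [yb fy].
  have [yla|ay] := ltP y a; first by right; apply: bbmK_diff_gt0 => //; rewrite yla.
  have [bly|yb'] := ltP b y; first by right; apply: bbmK_diff_gt0 => //; rewrite bly orbT.
  left; rewrite /h fy ?addNr ?expr0n ?mul0r//.
  by rewrite in_itv/= !lt_neqAle ay yb' !andbT; apply/andP; split; apply/eqP => // /esym.
have q0 : {ae mu, forall y, 0 <= q y}.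
  apply: ae_imp hJ => y; rewrite /q => -[->|Jy]; first by rewrite mulr0.
  by rewrite mulr_ge0// ltW.
have {}q0 : {ae mu, forall y, q y = 0}.
  by apply: integral_ae_ge0_eq0 => //; rewrite qE subr_le0.
(* From f = -1 almost everywhere it is enough to keep f^2 = 1, whose integral over the line is
   infinite although f^2 is integrable. *)
have f1 : {ae mu, forall y, f y ^+ 2 = 1}.
  apply: ae_imp2 hJ q0 => y hJy qy.
  have hy : h y = 0.
    case: hJy => // Jy; move: qy => /eqP; rewrite /q mulf_eq0 gt_eqF//=.
    by move/eqP.
  move: hy => /eqP; rewrite /h mulf_eq0 invr_eq0 pnatr_eq0 orbF sqrf_eq0 addr_eq0.
  by move=> /eqP ->; rewrite sqrrN expr1n.
have if2 := L2_integ_sqr L2f.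
have := integrable_fin_num measurableT if2.
rewrite (@ae_eq_integral _ _ _ mu _ (cst 1%E))//; last 2 first.
- exact: (measurable_int mu if2).
- by apply: ae_imp f1 => y fy _; rewrite /= fy.
rewrite integral_cst// mul1e -set_itvNyy.
by rewrite [X in X \is a fin_num]lebesgue_measure_itv.
Qed.

Lemma eq_cst_on_ae (s : R) f (c : R) a b : eq_cst_on s f c a b ->
  {ae mu, forall x, x \in `]a, b[ -> f x = c}.
Proof.
rewrite /eq_cst_on; case: ifP => // _ [g [_ gf gc]].
by apply: ae_imp gf => x gx xab; rewrite -gx gc.
Qed.

End bbm_rigidity.

Theorem corollary1p4 (R : realType) (s T : R) (hs : 0 <= s) (hT : 0 < T) :
  ~ exists (u0 : R -> R) (u : R -> R -> R),
      bbm_solution s T u0 u /\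
      exists t0 a b : R,
        [/\ t0 \in `]- T, T[, a < b,
            eq_cst_on s (u t0) (-1) a b &
            dt T u t0 a <= dt T u t0 b].
Proof.
move=> [u0 [u [sol [t0 [a [b [t0T ab ucst]]]]]]].
have v_dt := bbm_is_dt hs sol.
(* [dt] is a choice among all admissible derivatives; the choice is admissible because one exists,
   and uniqueness identifies it at the interior time t0. *)
have dtE x : dt T u t0 x = - bbm_nonlinearity (u t0) x.
  apply: (is_dt_unique x _ v_dt t0T).
  exact: (@xgetPex _ (fun _ _ => 0) [set v | is_dt T u v] (ex_intro _ _ v_dt)).
rewrite !dtE lerN2; apply: bbm_nonlinearity_rigidity ab (eq_cst_on_ae ucst).
have [_ Cu _] := sol.
by have [] := Cu t0 (subset_itv_oo_cc t0T) => -[].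
Qed.
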